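(* For all integers $p \ge 1$ and $q \ge 0$, the kite graph $Kite_{p}^{q}$ is determined by its adjacency spectrum; that is, every graph $G$ that has the same adjacency spectrum as $Kite_{p}^{q}$ is isomorphic to $Kite_{p}^{q}$.
   Context: All graphs are finite, simple and undirected (not necessarily connected). The adjacency spectrum of a graph is the multiset of eigenvalues (with multiplicity) of its $(0,1)$-adjacency matrix. The kite graph $Kite_{p}^{q}$ is obtained by appending the complete graph $K_{p}$ to a pendant vertex (endpoint) of the path $P_{q}$ on $q$ vertices: take disjoint copies of $K_p$ and $P_q$ and add one edge joining a vertex of $K_p$ to an endpoint of $P_q$. It has $p+q$ vertices. For $q=0$ it is the complete graph $K_p$; for $q=1$ it is $K_p$ with one pendant vertex attached; for $p\le 2$ it is a path. *)

(* Defs.v *)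
From mathcomp Require Import all_boot all_order all_algebra all_field.

Set Implicit Arguments.
Unset Strict Implicit.
Unset Printing Implicit Defensive.

Import GRing.Theory.
Local Open Scope ring_scope.

Record sgraph := SGraph {
  vertex :> finType;
  adj : rel vertex;
  adj_sym : symmetric adj;
  adj_irrefl : irreflexive adj
}.

Definition isomorphic (G H : sgraph) : Prop :=
  exists2 f : G -> H, bijective f & forall x y, adj (f x) (f y) = adj x y.

Definition adjacency_mx (G : sgraph) : 'M[algC]_#|G| :=
  \matrix_(i, j) (adj (enum_val i) (enum_val j))%:R.

(* The eigenvalues of A listed with multiplicity, in an arbitrary order: two
   spectra are the same multiset exactly when the lists are [perm_eq]. *)
Definition spectrum n (A : 'M[algC]_n) : seq algC :=
  sval (closed_field_poly_normal (char_poly A)).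

Lemma spectrumE n (A : 'M[algC]_n) :
  char_poly A = \prod_(z <- spectrum A) ('X - z%:P).
Proof.
rewrite /spectrum; case: closed_field_poly_normal => r /= {1}->.
by rewrite (monicP (char_poly_monic A)) scale1r.
Qed.

Lemma mem_spectrum n (A : 'M[algC]_n) a : (a \in spectrum A) = eigenvalue A a.
Proof. by rewrite eigenvalue_root_char spectrumE root_prod_XsubC. Qed.

Definition same_spectrum (G H : sgraph) : bool :=
  perm_eq (spectrum (adjacency_mx G)) (spectrum (adjacency_mx H)).

Definition determined_by_spectrum (H : sgraph) : Prop :=
  forall G : sgraph, same_spectrum G H -> isomorphic G H.

(* The left summand is K_p, the right summand is the path 0 - 1 - ... - (q-1);
   the extra edge joins vertex 0 of K_p to the endpoint 0 of the path. *)
Definition kite_adj (p q : nat) : rel ('I_p + 'I_q) := fun u v =>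
  match u, v with
  | inl i, inl j => i != j
  | inr i, inr j => (i.+1 == j :> nat) || (j.+1 == i :> nat)
  | inl i, inr j | inr j, inl i => (i == 0 :> nat) && (j == 0 :> nat)
  end%N.

Lemma kite_adj_sym p q : symmetric (@kite_adj p q).
Proof. by case=> i [] j //=; rewrite 1?eq_sym 1?orbC. Qed.

Lemma kite_adj_irrefl p q : irreflexive (@kite_adj p q).
Proof. by case=> i /=; rewrite ?eqxx // orbb gtn_eqF. Qed.

Definition kite (p q : nat) : sgraph :=
  SGraph (@kite_adj_sym p q) (@kite_adj_irrefl p q).

(* Main.v *)
Require Import Defs.
From mathcomp Require Import all_boot all_order all_algebra all_field.
From mathcomp Require Import zify ring.

(** Let G be cospectral with the kite K made of a clique on p vertices and a
    tail of q >= 1 vertices. The traces of the powers 0, 2, 3 and 4 of the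
    adjacency matrix show that G has as many vertices, edges, triangles and
    closed walks of length four as K. The proof finds a clique on p vertices
    in G; a comparison of degrees then leaves no freedom.

    Finding the clique (p >= 4). For an eigenvector of K with eigenvalue a the
    values along the tail, read from its end, are Chebyshev polynomials in a,
    and the equations at the junction become a single relation
    [kite_secular]. This relation cannot hold for a and for - a
    [kite_spectrum_asym]. A bipartite component of G would give such a pair of
    eigenvalues, so every component of G has a cycle, that is, at least as
    many edges as vertices, and therefore an eigenvalue at least 2. On the
    hyperplane where the sum over the clique without the junction vanishes,
    the form of 2 - A is positive definite for K, so only one eigenvalue of K
    is at least 2 [kite_large_eigenvalues]. Hence G is connected
    [spectrum_connected]. A connected graph with n vertices, whose number of
    edges is n - 1 + k (k - 1) / 2, has at most (k + 1) k (k - 1) / 6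
    triangles, and equality forces a clique on k + 1 vertices
    [triads_extremal]: a connected version of the Kruskal-Katona theorem. With
    k = p - 1 the counts of K reach equality. For p = 3 the clique is the
    single triangle.

    From the clique to the kite. A clique on p vertices already accounts for
    all the 4-cycles of K, so the closed walks of length four bound the sum of
    the squares of the degrees of G by that of K. Equivalently, the sum of
    (d - 1) (d - 2) over the degrees d of G is at most (p - 1) (p - 2) ^ 2, its
    value for K. If no vertex of the clique had a neighbour outside, p - 1
    would be an eigenvalue, which it is not for K. So some
    clique vertex has degree at least p, and the bound is exhausted: it has
    degree p, the other clique vertices have degree p - 1, and the vertices
    outside have degree 1 or 2 [excess_rigid]. A path starts at the junction;
    what is left over has all degrees 2 by the edge count, and is empty since
    2 is not an eigenvalue of K [kite_recognition]. For p <= 2 the same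
    argument starts from a leaf instead of a clique, and for q = 0 the edge
    count suffices. The lemmas on kites write p + 1 for the size of the clique. *)

Set Implicit Arguments.
Unset Strict Implicit.
Unset Printing Implicit Defensive.

(** * Counting edges and triangles *)

Definition nbhd (G : sgraph) (S : {set G}) (v : G) : {set G} :=
  [set u in S | adj v u].

Definition clique (G : sgraph) (Q : {set G}) : Prop :=
  {in Q &, forall x y, x != y -> adj x y}.

(** Twice the number of edges inside S. *)
Definition arcs (G : sgraph) (S : {set G}) : nat :=
  \sum_(x in S) \sum_(y in S) adj x y.

(** Six times the number of triangles inside S; on the whole graph this is the
    trace of the cube of the adjacency matrix. *)
Definition triads (G : sgraph) (S : {set G}) : nat :=
  \sum_(x in S) \sum_(y in S) \sum_(z in S) adj x y * adj y z * adj z x.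

Lemma card_nbhd (G : sgraph) (S : {set G}) (v : G) :
  #|nbhd S v| = \sum_(u in S) adj v u.
Proof.
rewrite -sum1_card /nbhd big_mkcond [RHS]big_mkcond /=.
by apply: eq_bigr => u _; rewrite inE; case: (u \in S); case: (adj v u).
Qed.

Lemma nbhd_sub (G : sgraph) (S : {set G}) (v : G) : nbhd S v \subset S.
Proof. by apply/subsetP=> u; rewrite inE => /andP[]. Qed.

Lemma sum_adjC (G : sgraph) (S : {set G}) (v : G) :
  \sum_(u in S) adj u v = #|nbhd S v|.
Proof. by rewrite card_nbhd; apply: eq_bigr => u _; rewrite adj_sym. Qed.

Lemma arcs_setU1 (G : sgraph) (S : {set G}) (v : G) :
  v \notin S -> arcs (v |: S) = arcs S + 2 * #|nbhd S v|.
Proof.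
move=> vS; rewrite /arcs big_setU1 //= big_setU1 //= adj_irrefl -card_nbhd.
under eq_bigr => x _ do rewrite big_setU1 //=.
by rewrite big_split /= sum_adjC; lia.
Qed.

Lemma arcs_nbhd (G : sgraph) (S : {set G}) (v : G) :
  arcs (nbhd S v) =
  \sum_(y in S) \sum_(z in S) adj v y * adj y z * adj z v.
Proof.
rewrite /arcs big_mkcond [RHS]big_mkcond /=; apply: eq_bigr => y _.
rewrite inE; case: (y \in S) => //=.
case vy: (adj v y); last by rewrite big1 // => z _; rewrite !mul0n.
rewrite big_mkcond [RHS]big_mkcond /=; apply: eq_bigr => z _.
rewrite inE (adj_sym z); case: (z \in S) => //=.
by case: (adj v z); case: (adj y z).
Qed.

Lemma triads_setU1 (G : sgraph) (S : {set G}) (v : G) :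
  v \notin S -> triads (v |: S) = triads S + 3 * arcs (nbhd S v).
Proof.
move=> vS; rewrite /triads big_setU1 //= big_setU1 //= adj_irrefl.
rewrite [X in X + _ + _]big1 ?add0n; last by move=> z _.
have -> : \sum_(y in S) \sum_(z in v |: S) adj v y * adj y z * adj z v =
          arcs (nbhd S v).
  rewrite arcs_nbhd; apply: eq_bigr => y _.
  by rewrite big_setU1 //= adj_irrefl muln0.
under eq_bigr => x _.
  rewrite big_setU1 //= big_setU1 //= adj_irrefl muln0 mul0n add0n.
  under [X in _ + X]eq_bigr => y _ do rewrite big_setU1 //=.
  rewrite big_split /=; over.
rewrite !big_split /=.
have -> : \sum_(x in S) \sum_(z in S) adj x v * adj v z * adj z x =
          arcs (nbhd S v).
  rewrite arcs_nbhd exchange_big /=; apply: eq_bigr => y _; apply: eq_bigr => z _.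
  by rewrite -mulnA mulnC.
have -> : \sum_(x in S) \sum_(y in S) adj x y * adj y v * adj v x =
          arcs (nbhd S v).
  rewrite arcs_nbhd; apply: eq_bigr => y _; apply: eq_bigr => z _.
  by rewrite mulnC mulnA.
lia.
Qed.

Lemma arcs_le (G : sgraph) (S : {set G}) : arcs S <= #|S| * #|S|.-1.
Proof.
rewrite /arcs -sum_nat_const; apply: leq_sum => x xS.
rewrite -card_nbhd (cardsD1 x S) xS /=; apply/subset_leq_card/subsetP => u.
rewrite !inE => /andP[-> xu]; rewrite andbT; apply: contraTneq xu => ->.
by rewrite adj_irrefl.
Qed.

Lemma arcs_clique (G : sgraph) (S : {set G}) :
  #|S| * #|S|.-1 <= arcs S -> clique S.
Proof.
move=> le_arcs x y xS yS neq_xy; apply/negPn/negP => nadj.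
have: arcs S < #|S| * #|S|.-1; last by rewrite ltnNge le_arcs.
rewrite /arcs -sum_nat_const (bigD1 x) //= [X in _ < X](bigD1 x) //=.
have le_deg z : z \in S -> \sum_(u in S) adj z u <= #|S|.-1.
  move=> zS; rewrite -card_nbhd (cardsD1 z S) zS /=.
  apply/subset_leq_card/subsetP => u.
  rewrite !inE => /andP[-> zu]; rewrite andbT; apply: contraTneq zu => ->.
  by rewrite adj_irrefl.
apply: (@leq_add _.+1); last by apply: leq_sum => z /andP[zS _]; apply: le_deg.
rewrite -card_nbhd (cardsD1 x S) xS /= (cardsD1 y (S :\ x)) !inE yS.
rewrite eq_sym neq_xy /= add1n ltnS; apply/subset_leq_card/subsetP => u.
rewrite !inE => /andP[-> xu]; rewrite andbT; apply/andP; split.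
  by apply: contraTneq xu => ->.
by apply: contraTneq xu => ->; rewrite adj_irrefl.
Qed.

(** The connected sets of vertices, generated by adding one adjacent vertex at a
    time; inductions over connected graphs then need no choice of a non-cut vertex. *)
Inductive grown (G : sgraph) : {set G} -> Prop :=
| Grown1 x : grown [set x]
| GrownU1 S v : grown S -> v \notin S -> nbhd S v != set0 -> grown (v |: S).

Lemma arcs_set1 (G : sgraph) (x : G) : arcs [set x] = 0.
Proof. by rewrite /arcs big_set1 big_set1 adj_irrefl. Qed.

Lemma triads_set1 (G : sgraph) (x : G) : triads [set x] = 0.
Proof. by rewrite /triads !big_set1 adj_irrefl. Qed.

Lemma grown_neq0 (G : sgraph) (S : {set G}) : grown S -> S != set0.
Proof.
by case=> [x|T v _ _ _]; apply/set0Pn; [exists x | exists v]; rewrite !inE eqxx.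
Qed.

Lemma grown_arcs_ge (G : sgraph) (S : {set G}) :
  grown S -> 2 * #|S| <= arcs S + 2.
Proof.
elim=> [x|T v _ IH vT]; first by rewrite cards1 arcs_set1.
by rewrite -card_gt0 arcs_setU1 // cardsU1 vT; lia.
Qed.

(** The cyclomatic number is monotone: every vertex added outside T brings at
    least one edge. *)
Lemma grown_arcs_sub (G : sgraph) (S T : {set G}) :
  grown S -> T \subset S -> T != set0 ->
  arcs T + 2 * #|S| <= arcs S + 2 * #|T|.
Proof.
move=> gS; elim: gS T => [x|{}S v gS IH vS Nv] T.
  by rewrite subset1 => /predU1P[->|/eqP->]; rewrite ?eqxx ?arcs_set1 ?leqnn.
move=> sTS T0; rewrite arcs_setU1 // cardsU1 vS.
have [vT|vT] := boolP (v \in T); last first.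
  have {}sTS: T \subset S.
    apply/subsetP => x xT; have := subsetP sTS x xT.
    by rewrite !inE => /predU1P[xv|//]; rewrite -xv xT in vT.
  by have := IH _ sTS T0; rewrite -card_gt0 in Nv; lia.
have eT := setD1K vT; have vT' : v \notin T :\ v by rewrite !inE eqxx.
have sT'S: T :\ v \subset S.
  apply/subsetP => x; rewrite !inE => /andP[xv xT].
  by have := subsetP sTS x xT; rewrite !inE (negPf xv).
have le_nbhd : #|nbhd (T :\ v) v| <= #|nbhd S v|.
  apply/subset_leq_card/subsetP => u; rewrite !inE => /andP[/andP[uv uT] ->].
  by rewrite (subsetP sT'S) // !inE uv.
rewrite -eT arcs_setU1 // cardsU1 vT'.
have [T'0|T'n0] := eqVneq (T :\ v) set0; last by have := IH _ sT'S T'n0; lia.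
have arcs0 : arcs (T :\ v) = 0 by rewrite T'0 /arcs big_set0.
have nbhd0 : nbhd (T :\ v) v = set0 by apply/setP => u; rewrite T'0 !inE.
rewrite arcs0 nbhd0 T'0 !cards0; rewrite -card_gt0 in Nv.
by have := grown_arcs_ge gS; lia.
Qed.

(** * Triangles in a connected graph of given cyclomatic number *)

(** The maximal number of triangles for cyclomatic number m is simplest at the
    triangular numbers m = j (j - 1) / 2, where it is (j + 1) j (j - 1) / 6. Between
    two consecutive ones the chord serves as a bound, and twelve times its value is
    (j + 1) (6 m - j (j - 1)); this finds the chord that belongs to m. *)
Lemma triangular_sandwich m : exists2 j, j * j.-1 <= 2 * m & 2 * m < j.+1 * j.
Proof.
elim: m => [|m [j le_jm lt_mj]]; first by exists 1.
have [lt_m1|le_m1] := ltnP (2 * m.+1) (j.+1 * j); first by exists j; lia.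
by exists j.+1 => //=; case: j le_jm lt_mj le_m1 => [|j] /=; nia.
Qed.

Lemma cube_pred i : i.+1 * i * i.-1 + i = i * (i * i).
Proof. by case: i => //= i; lia. Qed.

Lemma square_pred i : i * i.-1 + i = i * i.
Proof. by case: i => //= i; lia. Qed.

(** The values at the triangular numbers are in convex position, so the chord of
    the interval that contains m is above all the other chords at m. *)
Lemma chord_max i j m : j * j.-1 <= 2 * m -> 2 * m <= j.+1 * j ->
  i.+1 * (6 * m) + j.+1 * j * j.-1 <= j.+1 * (6 * m) + i.+1 * i * i.-1.
Proof.
have := (cube_pred i, cube_pred j); have := square_pred j.
set ci := _ * i.-1; set cj := _ * _ * j.-1; set sj := _ * j.-1.
move: ci cj sj => ci cj sj ej [ei3 ej3] lo hi.
have [lt_ij|lt_ji|eij] := ltngtP i j.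
- have [d ej'] : exists d, j = i + d.+1 by exists (j - i.+1); lia.
  have := leq_mul (leqnn (3 * d.+1)) lo; subst j; lia.
- have [d ei'] : exists d, i = j + d.+1 by exists (i - j.+1); lia.
  have := leq_mul (leqnn (3 * d.+1)) hi; subst i; lia.
by subst j; lia.
Qed.

(** Induction step of the triangle bound, for a new vertex with d + 1 neighbours
    that span e / 2 edges. If d <= j, the j-th chord has slope (j + 1) / 2, which
    pays for d (d + 1) / 2 triangles. Otherwise the bound by the cyclomatic number
    m is used, and it is paid for by passing to the next chord. *)
Lemma triads_step m m' d j e T :
  j * j.-1 <= 2 * m' -> 2 * m' < j.+1 * j ->
  2 * T + j.+1 * j * j.-1 <= j.+1 * (6 * m') ->
  m = m' + d -> e <= d.+1 * d -> e <= 2 * m ->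
  exists i, 2 * (T + 3 * e) + i.+1 * i * i.-1 <= i.+1 * (6 * m).
Proof.
move=> lo hi le_T -> le_e1 le_e2.
have [le_dj|lt_jd] := leqP d j.
  exists j; have := leq_mul (leqnn (6 * d)) (le_dj : d.+1 <= j.+1).
  by move: (_ * j.-1) le_T => c le_T; lia.
exists j.+1 => /=; have := cube_pred j.
move: (_ * j.-1) le_T => c le_T ej3.
by have := leq_mul (leqnn (6 * j)) lt_jd; lia.
Qed.

(** When the bound is attained at a triangular number, both cases of
    [triads_step] leave a positive slack, except if the new vertex is joined to
    exactly k vertices that form a clique. *)
Lemma triads_step_tight k m m' d j e T :
  2 * m = k * k.-1 ->
  j * j.-1 <= 2 * m' -> 2 * m' < j.+1 * j ->
  2 * T + j.+1 * j * j.-1 <= j.+1 * (6 * m') ->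
  m = m' + d -> e <= d.+1 * d -> e <= 2 * m -> 0 < d ->
  k.+1 * k * k.-1 <= T + 3 * e ->
  k = d.+1 /\ e = d.+1 * d.
Proof.
move=> ek lo hi le_T em le_e1 le_e2 d0 le_k.
have [le_dj|lt_jd] := leqP d j.
  have lt_jk : j < k.
    rewrite ltnNge; apply/negP => le_kj.
    have := leq_mul le_kj (_ : k.-1 <= j.-1); lia.
  (* With k = j + 1 + s the slack is a sum of nonnegative terms, so s = 0. *)
  have [s es] : exists s, k = j.+1 + s by exists (k - j.+1); lia.
  have := cube_pred j; have := leq_mul (leqnn d) (le_dj : d.+1 <= j.+1).
  move: (_ * j.-1) le_T => c le_T le_dd ej.
  have key : 6 * (d * j.+1) + s.+1 * s * (3 * j + 1 + 2 * s) <= 6 * e.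
    by subst k; subst m; rewrite /= in le_k ek; lia.
  have s0 : s = 0 by apply/eqP; have : s.+1 * s * (3 * j + 1 + 2 * s) == 0;
    [lia | rewrite !muln_eq0; lia].
  subst s; have e_eq : e = d.+1 * d by lia.
  have : d * d.+1 == d * j.+1 by lia.
  by rewrite eqn_pmul2l //; lia.
(* If d > j, the slack on chord j + 1 contradicts its position below chord k at m. *)
have := @chord_max j.+1 k m; rewrite ek => /(_ (leqnn _)) /=.
have -> : k * k.-1 <= k.+1 * k by rewrite mulnC leq_mul2r; lia.
move=> /(_ isT) /=.
have := cube_pred j; have := leq_mul (leqnn (6 * j)) lt_jd.
move: (_ * j.-1) le_T => c le_T le_j6 ej.
have := cube_pred k; move: (_ * k.-1) le_k => K le_k eK.
have := square_pred k; move: (k * k.-1) ek => K2 ek eK2.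
by subst m; lia.
Qed.

(** Two bounds on the number e / 2 of edges spanned by the neighbours of the new
    vertex drive the induction: the number of pairs, and, since the new vertex
    with its neighbours has cyclomatic number e / 2, the cyclomatic number m of
    the larger set. *)
Lemma grown_mu_pred (G : sgraph) (S : {set G}) (v : G) m :
  grown S -> v \notin S -> nbhd S v != set0 ->
  arcs (v |: S) + 2 = 2 * (m + #|v |: S|) ->
  exists m', [/\ arcs S + 2 = 2 * (m' + #|S|),
    m = m' + #|nbhd S v|.-1, arcs (nbhd S v) <= 2 * m &
    arcs (nbhd S v) <= #|nbhd S v|.-1.+1 * #|nbhd S v|.-1].
Proof.
move=> gS vS N0; have := grown_arcs_sub gS (nbhd_sub S v) N0.
have := grown_arcs_ge gS; have := arcs_le (nbhd S v); rewrite -card_gt0 in N0.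
rewrite arcs_setU1 // cardsU1 vS prednK // => le_N ge_S ge_N em.
exists (m - #|nbhd S v|.-1); split=> //; lia.
Qed.

Lemma triads_le (G : sgraph) (S : {set G}) m j :
  grown S -> arcs S + 2 = 2 * (m + #|S|) ->
  j * j.-1 <= 2 * m -> 2 * m <= j.+1 * j ->
  2 * triads S + j.+1 * j * j.-1 <= j.+1 * (6 * m).
Proof.
move=> gS; elim: gS m j => [x|{}S v gS IH vS N0] m j em lo hi.
  rewrite triads_set1 arcs_set1 cards1 in em *.
  have m0 : m = 0 by lia.
  have j1 : j * j.-1 == 0 by lia.
  by rewrite -mulnA (eqP j1); lia.
have [m' [em' emm le_e1 le_e2]] := grown_mu_pred gS vS N0 em.
have [j' lo' hi'] := triangular_sandwich m'.
have le_T' := IH _ _ em' lo' (ltnW hi').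
have [i le_T] := triads_step lo' hi' le_T' emm le_e2 le_e1.
have := chord_max i lo hi; rewrite triads_setU1 //.
by move: le_T; move: (_ * i.-1) (_ * j.-1) => x y; lia.
Qed.

(** A connected graph of cyclomatic number k (k - 1) / 2 with as many triangles
    as a clique on k + 1 vertices contains such a clique: following the growth of S,
    the last vertex that closes a cycle completes it. *)
Theorem triads_extremal (G : sgraph) (S : {set G}) k :
  1 < k -> grown S -> arcs S + 2 = k * k.-1 + 2 * #|S| ->
  k.+1 * k * k.-1 <= triads S ->
  exists2 Q : {set G}, clique Q & #|Q| = k.+1.
Proof.
move=> k1 gS; elim: gS => [x|{}S v gS IH vS N0] em le_k.
  by move: le_k; rewrite triads_set1 leqn0 !muln_eq0; lia.
have [m em2] : exists m, 2 * m = k * k.-1.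
  by exists 'C(k, 2); rewrite bin2 mul2n halfK; case: k {k1 em le_k IH} => //= k;
     rewrite oddM /=; case: (odd k); rewrite subn0.
rewrite -em2 -mulnDr in em.
have [m' [em' emm le_e1 le_e2]] := grown_mu_pred gS vS N0 em.
rewrite triads_setU1 // in le_k.
(* A pendant vertex changes neither the triangles nor the cyclomatic number. *)
have [d0|d0] := posnP #|nbhd S v|.-1.
  apply: IH; first by rewrite -em2; lia.
  by move: le_e2; rewrite d0 muln0 leqn0 => /eqP e0; rewrite e0 addn0 in le_k.
have [j lo hi] := triangular_sandwich m'.
(* The vertex closes a cycle; the bound for S before it must be tight. *)
have le_T := triads_le gS em' lo (ltnW hi).
have [ek e_eq] := triads_step_tight em2 lo hi le_T emm le_e2 le_e1 d0 le_k.
rewrite prednK ?card_gt0 // in ek e_eq.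
exists (v |: nbhd S v); last first.
  by rewrite cardsU1 !inE (negPf vS) ek.
have cN : clique (nbhd S v) by apply: arcs_clique; rewrite e_eq.
move=> x y /setU1P[->|xN] /setU1P[->|yN]; first by rewrite eqxx.
- by move: yN; rewrite inE => /andP[].
- by move: xN; rewrite inE adj_sym => /andP[].
- exact: cN.
Qed.

(** * Connected components *)

Definition adj_closed (G : sgraph) (S : {set G}) : Prop :=
  forall u v, u \in S -> adj u v -> v \in S.

Lemma adj_closedC (G : sgraph) (S : {set G}) : adj_closed S -> adj_closed (~: S).
Proof.
move=> cS u v; rewrite !inE => uS uv; apply: contra uS => vS.
by apply: cS vS _; rewrite adj_sym.
Qed.

(** A connected set that cannot be enlarged is a component. *)
Lemma grown_closure (G : sgraph) (x : G) :
  exists S : {set G}, [/\ grown S, x \in S & adj_closed S].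
Proof.
have: grown [set x] /\ x \in [set x] by split; [constructor | rewrite inE].
move: [set x] => S [gS xS]; move: {2}#|~: S|.+1 (ltnSn #|~: S|) => n.
elim: n => // n IH in S gS xS * => le_n.
have [/existsP[v /andP[vS Nv]]|] :=
  boolP [exists v, (v \notin S) && (nbhd S v != set0)].
  apply: (IH (v |: S)); [exact: GrownU1 | by rewrite inE xS orbT |].
  have -> : ~: (v |: S) = (~: S) :\ v by apply/setP => u; rewrite !inE negb_or.
  by move: le_n; rewrite (cardsD1 v (~: S)) inE vS.
rewrite negb_exists => /forallP cS; exists S; split=> // u v uS uv.
have := cS v; rewrite negb_and negbK => /orP[//|/negPn/eqP N0].
by have := in_set0 u; rewrite -N0 inE uS adj_sym uv.
Qed.

Lemma grown_in_closed (G : sgraph) (S T : {set G}) :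
  grown S -> adj_closed T -> S \subset T \/ S \subset ~: T.
Proof.
move=> gS cT; elim: gS => [x|{}S v _ IH _ /set0Pn[u]].
  by rewrite !sub1set inE; case: (x \in T); [left | right].
rewrite inE adj_sym => /andP[uS uv].
case: IH => sST; [left|right]; apply/subsetP => w /setU1P[->|/(subsetP sST)//].
  exact: cT (subsetP sST _ uS) uv.
exact: (adj_closedC cT) (subsetP sST _ uS) uv.
Qed.

(** Fewer edges than vertices means that each new vertex has a single earlier
    neighbour, whose opposite colour it receives. *)
Lemma grown_tree_bipartite (G : sgraph) (S : {set G}) :
  grown S -> arcs S < 2 * #|S| ->
  exists c : G -> bool, {in S &, forall x y, adj x y -> c x != c y}.
Proof.
elim=> [x _|{}S v gS IH vS Nv].
  by exists xpredT => y z /set1P-> /set1P->; rewrite adj_irrefl.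
have := grown_arcs_ge gS; rewrite arcs_setU1 // cardsU1 vS => ge_S le_S.
have [|c cP] := IH; first by rewrite -card_gt0 in Nv; lia.
have /cards1P[u Nu] : #|nbhd S v| == 1 by rewrite -card_gt0 in Nv; lia.
have onlyu y : y \in S -> adj v y -> y = u.
  by move=> yS vy; apply/set1P; rewrite -Nu inE yS.
have c'P y : y \in S -> (if y == v then ~~ c u else c y) = c y.
  by case: eqP => // ->; rewrite (negPf vS).
exists (fun y => if y == v then ~~ c u else c y) => x y.
move=> /setU1P[->|xS] /setU1P[->|yS]; rewrite ?adj_irrefl // ?eqxx ?c'P //.
- by move=> /(onlyu _ yS)->; case: (c u).
- by rewrite adj_sym => /(onlyu _ xS)->; case: (c u).
- exact: cP.
Qed.

(** * Degrees and closed walks of length four *)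

Definition deg (G : sgraph) (x : G) : nat := #|nbhd [set: G] x|.

Lemma degE (G : sgraph) (x : G) : deg x = \sum_(y : G) adj x y.
Proof. by rewrite /deg card_nbhd; apply: eq_bigl => y; rewrite inE. Qed.

Lemma in_nbhdT (G : sgraph) (x y : G) : (y \in nbhd [set: G] x) = adj x y.
Proof. by rewrite !inE. Qed.

Lemma arcsT (G : sgraph) : arcs [set: G] = \sum_(x : G) deg x.
Proof.
rewrite /arcs; apply: eq_big => [x|x _]; first by rewrite inE.
by rewrite /deg card_nbhd.
Qed.

Definition codeg (G : sgraph) (x y : G) : nat := \sum_(z : G) adj x z * adj z y.

(** Closed walks of length four: the trace of the square of the matrix of
    common-neighbour counts. *)
Definition walks4 (G : sgraph) : nat := \sum_(x : G) \sum_(y : G) codeg x y ^ 2.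

Lemma codegE (G : sgraph) (x y : G) :
  codeg x y = #|[set z | adj x z && adj z y]|.
Proof.
rewrite -sum1_card [RHS]big_mkcond; apply: eq_bigr => z _.
by rewrite inE; case: (adj x z); case: (adj z y).
Qed.

Lemma codegxx (G : sgraph) (x : G) : codeg x x = deg x.
Proof.
rewrite degE; apply: eq_bigr => z _.
by rewrite (adj_sym z); case: (adj x z).
Qed.

Lemma sum_codeg (G : sgraph) :
  \sum_(x : G) \sum_(y : G) codeg x y = \sum_(z : G) deg z ^ 2.
Proof.
under eq_bigr do rewrite exchange_big /=.
rewrite exchange_big /=; apply: eq_bigr => z _.
under eq_bigr do rewrite -big_distrr /=.
rewrite -big_distrl /= degE -mulnn; congr (_ * _).
by apply: eq_bigr => x _; rewrite adj_sym.
Qed.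

(** The degenerate closed walks x y x z are counted by degrees; the 4-cycles are
    counted by ordered pairs of common neighbours of two distinct vertices. *)
Lemma walks4E (G : sgraph) :
  walks4 G + \sum_(x : G) deg x = 2 * (\sum_(x : G) deg x ^ 2) +
  \sum_(x : G) \sum_(y : G | y != x) codeg x y * (codeg x y).-1.
Proof.
rewrite mul2n -addnn -{2}sum_codeg -!big_split /=.
apply: eq_bigr => x _; rewrite (bigD1 x) //= [in RHS](bigD1 x) //= codegxx.
have -> : \sum_(y | y != x) codeg x y ^ 2 = \sum_(y | y != x) codeg x y +
            \sum_(y | y != x) codeg x y * (codeg x y).-1.
  rewrite -big_split /=; apply: eq_bigr => y _.
  by case: (codeg x y) => //= c; rewrite expnS expn1; lia.
by lia.
Qed.

Lemma clique_codeg (G : sgraph) (Q : {set G}) (x y : G) :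
  clique Q -> x \in Q -> y \in Q -> y != x -> #|Q|.-2 <= codeg x y.
Proof.
move=> cQ xQ yQ neq_yx; rewrite codegE (cardsD1 x Q) xQ.
rewrite (cardsD1 y (Q :\ x)) !inE neq_yx yQ /=; apply/subset_leq_card/subsetP.
move=> z; rewrite !inE => /and3P[zy zx zQ].
by apply/andP; split; apply: cQ; rewrite // eq_sym.
Qed.

(** Two vertices of a clique have the rest of the clique as common neighbours. *)
Lemma walks4_clique (G : sgraph) (Q : {set G}) : clique Q ->
  2 * (\sum_(x : G) deg x ^ 2) + #|Q| * (#|Q|.-1 * (#|Q|.-2 * #|Q|.-2.-1))
    <= walks4 G + \sum_(x : G) deg x.
Proof.
move=> cQ; rewrite walks4E leq_add2l -sum_nat_const.
rewrite [X in _ <= X](bigID (mem Q)) /=; apply: leq_trans (leq_addr _ _).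
apply: leq_sum => x xQ; rewrite [X in _ <= X](bigID (mem Q)) /=.
apply: leq_trans (leq_addr _ _).
set m := _ * #|Q|.-2.-1; have -> : #|Q|.-1 = #|[pred y | (y != x) && (y \in Q)]|.
  rewrite (cardsD1 x Q) xQ /=.
  by apply: eq_card => y; rewrite !inE.
rewrite -sum_nat_const; apply: leq_sum => y /andP[yx yQ].
have le_c := clique_codeg cQ xQ yQ yx.
by apply: leq_mul => //; lia.
Qed.

(** * Rigidity of the degrees around a clique *)

Lemma clique_deg (G : sgraph) (Q : {set G}) (x : G) :
  clique Q -> x \in Q -> #|Q|.-1 <= deg x.
Proof.
move=> cQ xQ; rewrite (cardsD1 x Q) xQ; apply/subset_leq_card/subsetP => y.
by rewrite in_nbhdT !inE => /andP[yx yQ]; apply: cQ; rewrite // eq_sym.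
Qed.

(** (d - 1) (d - 2), in a form that is also right for d = 0; it vanishes exactly
    for d = 1 and d = 2, and is otherwise positive. *)
Definition excess d := d ^ 2 + 2 - 3 * d.

Lemma excessE d : excess d + 3 * d = d ^ 2 + 2.
Proof. by rewrite /excess expnS expn1; case: d => [|[|d]] //; lia. Qed.

Lemma excess0 d : excess d = 0 -> 0 < d <= 2.
Proof.
have := excessE d; rewrite expnS expn1 => + e0; rewrite e0.
by case: d {e0} => [|[|[|d]]] //; lia.
Qed.

Lemma excessS d : excess d.+1 = d * d.-1.
Proof. by have := excessE d.+1; rewrite expnS expn1; case: d => //= d; lia. Qed.

Lemma leqif_excess c d : 1 < c -> c <= d ->
  excess c <= excess d ?= iff (d == c).
Proof.
case: c => // c c0 le_cd; have [->|neq_dc] := eqVneq d c.+1.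
  exact: leqif_refl.
case: d le_cd neq_dc => // d le_cd neq_dc.
have lt_cd : c < d by lia.
have : excess c.+1 < excess d.+1.
  rewrite !excessS; apply: (@leq_trans (d * c.-1.+1)); last first.
    by apply: leq_mul => //; lia.
  by rewrite prednK // mulnC ltn_mul2r; lia.
by move=> lt_e; split; [apply: ltnW | apply/negbTE; rewrite ltn_eqF].
Qed.

Definition kite_degrees (G : sgraph) (Q : {set G}) (v0 : G) : Prop :=
  [/\ clique Q, v0 \in Q, deg v0 = #|Q|,
      {in Q, forall x, x != v0 -> deg x = #|Q|.-1} &
      forall x, x \notin Q -> 0 < deg x <= 2].

(** The vertices of Q have degree at least |Q| - 1 and v0 even |Q|, so the left
    side is at least the right side termwise; equality of the sums makes every
    term equal. *)
Lemma excess_rigid (G : sgraph) (Q : {set G}) (v0 : G) :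
  clique Q -> 2 < #|Q| -> v0 \in Q -> #|Q| <= deg v0 ->
  \sum_(x : G) excess (deg x) <= excess #|Q| + #|Q|.-1 * excess #|Q|.-1 ->
  kite_degrees Q v0.
Proof.
move=> cQ Q3 v0Q degv0.
pose E x := if x == v0 then excess #|Q| else
            if x \in Q then excess #|Q|.-1 else 0.
pose C x := if x == v0 then deg x == #|Q| else
            if x \in Q then deg x == #|Q|.-1 else excess (deg x) == 0.
have leE x : true -> E x <= excess (deg x) ?= iff C x.
  move=> _; rewrite /E /C; case: eqP => [->|_]; first by apply: leqif_excess; lia.
  case: ifP => [xQ|_]; last by split; rewrite 1?eq_sym.
  by apply: leqif_excess; [lia | exact: clique_deg].
have <- : \sum_x E x = excess #|Q| + #|Q|.-1 * excess #|Q|.-1.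
  rewrite (bigD1 v0) //= {1}/E eqxx; congr (_ + _).
  have -> : #|Q|.-1 = #|Q :\ v0| by rewrite (cardsD1 v0 Q) v0Q.
  rewrite -sum_nat_const big_mkcond [RHS]big_mkcond; apply: eq_bigr => x _.
  rewrite /E !inE; case: eqP => //= _; case: (x \in Q) => //.
  by rewrite (cardsD1 v0 Q) v0Q.
rewrite (geq_leqif (leqif_sum leE)) => /forallP allC; split=> //.
- by have := allC v0; rewrite /C eqxx => /eqP.
- by move=> x xQ xv0; have := allC x; rewrite /C (negPf xv0) xQ => /eqP.
move=> x xQ; have := allC x; rewrite /C (negPf xQ).
have -> : (x == v0) = false by apply: contraNF xQ => /eqP->.
by move=> /eqP/excess0.
Qed.

(** * Isomorphisms *)

Lemma isomorphic_inj (G H : sgraph) (g : H -> G) :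
  injective g -> #|G| <= #|H| -> (forall x y, adj (g x) (g y) = adj x y) ->
  isomorphic G H.
Proof.
move=> inj_g leGH gP; have [f gK fK] := inj_card_bij inj_g leGH.
exists f; first by exists g.
by move=> x y; rewrite -gP !fK.
Qed.

Lemma isomorphic_sym (G H : sgraph) : isomorphic G H -> isomorphic H G.
Proof.
case=> f [g fK gK] fP; exists g; first by exists f.
by move=> x y; rewrite -fP !gK.
Qed.

Lemma isomorphic_trans (G H K : sgraph) :
  isomorphic G H -> isomorphic H K -> isomorphic G K.
Proof.
case=> f bij_f fP [g bij_g gP]; exists (g \o f); first exact: bij_comp.
by move=> x y; rewrite /= gP fP.
Qed.

Lemma isomorphic_complete (G H : sgraph) : #|G| = #|H| ->
  clique [set: G] -> clique [set: H] -> isomorphic G H.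
Proof.
move=> eqGH cG cH; pose g (x : H) : G := enum_val (cast_ord (esym eqGH) (enum_rank x)).
have inj_g : injective g by move=> x y /enum_val_inj/cast_ord_inj/enum_rank_inj.
apply: (isomorphic_inj inj_g) => [|x y]; first by rewrite eqGH.
have [->|xy] := eqVneq x y; first by rewrite !adj_irrefl.
by rewrite cH ?inE // cG ?inE // (inj_eq inj_g).
Qed.

(** * Recognising a kite from its degrees *)

Lemma clique_inner (G : sgraph) (Q : {set G}) (v0 x y : G) :
  kite_degrees Q v0 -> x \in Q -> x != v0 -> adj x y = (y \in Q) && (y != x).
Proof.
case=> cQ _ _ degQ _ xQ xv0; rewrite -in_nbhdT.
have -> : nbhd [set: G] x = Q :\ x.
  apply/esym/eqP; rewrite eqEcard -[X in X <= _]/(deg x) (degQ _ xQ xv0).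
  rewrite (cardsD1 x Q) xQ leqnn andbT; apply/subsetP => z.
  by rewrite in_nbhdT !inE => /andP[zx zQ]; apply: cQ; rewrite // eq_sym.
by rewrite !inE andbC.
Qed.

Lemma clique_root (G : sgraph) (Q : {set G}) (v0 w y : G) :
  kite_degrees Q v0 -> w \notin Q -> adj v0 w ->
  adj v0 y = (y == w) || (y \in Q) && (y != v0).
Proof.
case=> cQ v0Q degv0 _ _ wQ v0w; rewrite -in_nbhdT.
have -> : nbhd [set: G] v0 = w |: Q :\ v0.
  apply/esym/eqP; rewrite eqEcard -[X in X <= _]/(deg v0) degv0.
  rewrite cardsU1 !inE (negPf wQ) andbF (cardsD1 v0 Q) v0Q leqnn andbT.
  apply/subsetP => z; rewrite in_nbhdT !inE => /predU1P[->//|/andP[zx zQ]].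
  by apply: cQ; rewrite // eq_sym.
by rewrite !inE [in RHS]andbC.
Qed.

Definition kite_tail (G : sgraph) (Q : {set G}) (v0 : G) (s : seq G) : Prop :=
  [/\ uniq s, {in s, forall x, x \notin Q} & path (@adj G) v0 s].

Section Tail.

Variables (G : sgraph) (Q : {set G}) (v0 : G) (s : seq G).
Hypotheses (kQ : kite_degrees Q v0) (ts : kite_tail Q v0 s) (s0 : 0 < size s).

Local Notation t i := (nth v0 (v0 :: s) i).

Lemma tail_step i : i < size s -> adj (t i) (t i.+1).
Proof. by case: ts => _ _ /(pathP v0); apply. Qed.

Lemma tail_uniq : uniq (v0 :: s).
Proof.
case: ts kQ => us sQ _ [_ v0Q _ _ _]; rewrite /= us andbT.
by apply: contraL v0Q => /sQ.
Qed.

Lemma tail_notin i : i < size s -> t i.+1 \notin Q.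
Proof. by case: ts => _ sQ _ lt_is; apply: sQ; rewrite /= mem_nth. Qed.

Lemma tail_inj i j : i <= size s -> j <= size s -> t i = t j -> i = j.
Proof.
by move=> le_i le_j /eqP; rewrite (nth_uniq _ _ _ tail_uniq) // => /eqP.
Qed.

Lemma tail_inner i y : i.+1 < size s ->
  adj (t i.+1) y = (y == t i) || (y == t i.+2).
Proof.
move=> lt_is; case: kQ => _ _ _ _ /(_ _ (tail_notin (ltnW lt_is))) /andP[_ le2].
rewrite -in_nbhdT; have -> : nbhd [set: G] (t i.+1) = [set t i; t i.+2].
  apply/esym/eqP; rewrite eqEcard cards2.
  have -> : t i != t i.+2 by apply/eqP => /tail_inj; lia.
  rewrite [X in _ && X]le2 andbT; apply/subsetP => z.
  rewrite in_nbhdT !inE => /orP[]/eqP->; last exact: tail_step.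
  by rewrite adj_sym; apply: tail_step; apply: ltnW.
by rewrite !inE.
Qed.

(** A neighbour of the last vertex other than its predecessor is new, because all
    the earlier vertices already have their full set of neighbours. *)
Lemma tail_end y : adj (t (size s)) y ->
  y = t (size s).-1 \/ (y \notin Q) && (y \notin s).
Proof.
case: kQ => cQ v0Q degv0 degQ deg_out endy.
have endQ : t (size s) \notin Q.
  by rewrite -(prednK s0); apply: tail_notin; rewrite prednK.
have [yv0|yv0] := eqVneq y v0.
  left; move: endy; rewrite yv0 adj_sym.
  rewrite (clique_root _ kQ (tail_notin s0) (tail_step s0)) (negPf endQ) orbF.
  by move/eqP/tail_inj => ->.
have [yQ|yQ] := boolP (y \in Q).
  by move: endy; rewrite adj_sym (clique_inner _ kQ yQ yv0) (negPf endQ).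
have [ys|ys] := boolP (y \in s); last by right.
left; have [i lt_is ey] : exists2 i, i < size s & y = t i.+1.
  by exists (index y s); rewrite ?index_mem //= nth_index.
have [lt_i1s|le_si1] := ltnP i.+1 (size s).
  move: endy; rewrite adj_sym ey tail_inner // => /orP[]/eqP/tail_inj.
    by move=> e; lia.
  by move=> e; congr (t _); lia.
have ei : i.+1 = size s by lia.
by move: endy; rewrite ey ei adj_irrefl.
Qed.

End Tail.

(** A path that cannot be extended ends in a leaf. *)
Lemma tail_exists (G : sgraph) (Q : {set G}) (v0 : G) :
  kite_degrees Q v0 ->
  exists s, [/\ kite_tail Q v0 s, 0 < size s &
    forall y, adj (nth v0 (v0 :: s) (size s)) y -> y = nth v0 (v0 :: s) (size s).-1].
Proof.
move=> kQ; case: (kQ) => cQ v0Q degv0 _ _.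
have [w wQ v0w] : exists2 w, w \notin Q & adj v0 w.
  have /subsetPn[w] : ~~ (nbhd [set: G] v0 \subset Q :\ v0).
    apply/negP => /subset_leq_card; rewrite -[X in X <= _]/(deg v0) degv0.
    by rewrite (cardsD1 v0 Q) v0Q add1n ltnn.
  rewrite in_nbhdT !inE negb_and negbK => v0w /predU1P[ew|wQ]; last by exists w.
  by rewrite ew adj_irrefl in v0w.
have ts : kite_tail Q v0 [:: w].
  by split; rewrite //= ?v0w // => x; rewrite inE => /eqP->.
move: [:: w] ts (isT : 0 < size [:: w]) => s.
move: {2}(#|G| - size s) (leqnn (#|G| - size s)) => n.
elim: n s => [|n IH] s le_n ts s0; have us : uniq s by case: ts.
  exists s; split=> // y /(tail_end kQ ts s0)[//|/andP[yQ ys]].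
  have := max_card [in v0 :: y :: s].
  rewrite (card_uniqP _) /=.
    rewrite leqn0 subn_eq0 in le_n => lt_s.
    by have := leq_trans lt_s le_n; lia.
  rewrite inE negb_or ys us !andbT; apply/andP; split.
    by apply: contraNneq yQ => <-.
  by have := tail_uniq kQ ts => /= /andP[].
have [/existsP[y /and3P[ly yQ ys]]|] :=
  boolP [exists y, [&& adj (last v0 s) y, y \notin Q & y \notin s]].
  apply: (IH (rcons s y)); first by rewrite size_rcons; lia.
    case: ts => _ sQ ps; split; first by rewrite rcons_uniq ys.
      by move=> x; rewrite mem_rcons inE => /predU1P[->//|/sQ].
    by rewrite rcons_path ps.
  by rewrite size_rcons.
rewrite negb_exists => /forallP noext; exists s; split=> // y ly.
have := noext y; rewrite (last_nth v0) ly /= => nyQs.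
by case: (tail_end kQ ts s0 ly) => [//|yQs]; rewrite yQs in nyQs.
Qed.

Section Unfold.

Variables (G : sgraph) (Q : {set G}) (v0 : G) (s : seq G).
Hypotheses (kQ : kite_degrees Q v0) (ts : kite_tail Q v0 s) (s0 : 0 < size s).
Hypothesis s_end : forall y, adj (nth v0 (v0 :: s) (size s)) y ->
  y = nth v0 (v0 :: s) (size s).-1.

Local Notation t i := (nth v0 (v0 :: s) i).
Local Notation Qs := (v0 :: enum (Q :\ v0)).

Definition unfold_kite (u : kite #|Q| (size s)) : G :=
  match u with inl i => nth v0 Qs i | inr j => nth v0 s j end.

Lemma size_Qs : size Qs = #|Q|.
Proof. by case: kQ => _ v0Q _ _ _; rewrite /= -cardE (cardsD1 v0 Q) v0Q. Qed.

Lemma uniq_Qs : uniq Qs.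
Proof. by rewrite /= enum_uniq mem_enum !inE eqxx. Qed.

Lemma mem_Qs i : i < #|Q| -> nth v0 Qs i \in Q.
Proof.
case: kQ => _ v0Q _ _ _; case: i => //= i lt_i.
suff: nth v0 (enum (Q :\ v0)) i \in Q :\ v0 by rewrite !inE => /andP[].
by rewrite -mem_enum mem_nth //; rewrite -size_Qs in lt_i.
Qed.

Lemma nth_Qs_eq i j : i < #|Q| -> j < #|Q| -> (nth v0 Qs i == nth v0 Qs j) = (i == j).
Proof. by move=> lt_i lt_j; rewrite nth_uniq ?size_Qs // uniq_Qs. Qed.

Lemma tail_eq i j : i <= size s -> j <= size s -> (t i == t j) = (i == j).
Proof. by move=> le_i le_j; rewrite nth_uniq // (tail_uniq kQ ts). Qed.

Lemma unfold_kite_inj : injective unfold_kite.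
Proof.
move=> [i|i] [j|j] /= /eqP.
- by rewrite nth_Qs_eq // => /eqP/val_inj->.
- move/eqP => e; have := mem_Qs (ltn_ord i).
  by rewrite e (negPf (tail_notin ts (ltn_ord j))).
- move/eqP => e; have := mem_Qs (ltn_ord j).
  by rewrite -e (negPf (tail_notin ts (ltn_ord i))).
by rewrite (@tail_eq i.+1 j.+1) // => /eqP[]/val_inj->.
Qed.

Lemma unfold_kite_adj u v : adj (unfold_kite u) (unfold_kite v) = adj u v.
Proof.
have notin (j : 'I_(size s)) : nth v0 s j \notin Q by exact: (tail_notin ts).
have adjQ (i : 'I_#|Q|) y : adj (nth v0 Qs i) y =
    (i == 0 :> nat) && (y == t 1) || (y \in Q) && (y != nth v0 Qs i).
  case: posnP => [->|i0].
    exact: (clique_root _ kQ (tail_notin ts s0) (tail_step ts s0)).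
  have neq : nth v0 Qs i != nth v0 Qs 0.
    by rewrite nth_Qs_eq -?lt0n //; apply: leq_trans (ltn_ord i).
  by rewrite (clique_inner _ kQ) ?mem_Qs // andFb orFb.
have mixed (i : 'I_#|Q|) (j : 'I_(size s)) :
    adj (nth v0 Qs i) (nth v0 s j) = (i == 0 :> nat) && (j == 0 :> nat).
  by rewrite adjQ (negPf (notin j)) orbF (@tail_eq j.+1 1).
case: u v => [i|i] [j|j].
- rewrite /= adjQ mem_Qs // nth_Qs_eq //=.
  have -> : (nth v0 Qs j == t 1) = false.
    apply: contraNF (tail_notin ts s0) => /eqP<-; exact: mem_Qs.
  by rewrite andbF /= eq_sym.
- exact: mixed.
- by rewrite adj_sym [RHS]adj_sym; exact: mixed.
rewrite -[unfold_kite (inr i)]/(t i.+1) -[unfold_kite (inr j)]/(t j.+1).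
have [lt_i1s|le_si1] := ltnP i.+1 (size s).
  rewrite (tail_inner kQ ts) // !tail_eq //= ?(ltnW (ltn_ord i)) //.
  by rewrite orbC eqSS [in X in X || _]eq_sym.
have ei : size s = i.+1 by have := ltn_ord i; lia.
have -> : adj (t i.+1) (t j.+1) = (t j.+1 == t i).
  apply/idP/eqP => [|->].
    have s_end' k : k = size s -> forall y, adj (t k) y -> y = t k.-1 by move=> ->.
    exact: s_end' (esym ei) _.
  by rewrite adj_sym; apply: (tail_step ts).
rewrite tail_eq // ?(ltnW (ltn_ord i)) //=.
by have -> : (i.+1 == j :> nat) = false by apply/eqP => e; have := ltn_ord j; lia.
Qed.

End Unfold.

(** The clique and a maximal tail leave exactly degree 2 on average for the other
    vertices, whose degrees are at most 2; hence they form a 2-regular union of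
    components, excluded by hypothesis. *)
Lemma kite_recognition (G : sgraph) (Q : {set G}) (v0 : G) q :
  kite_degrees Q v0 -> #|G| = #|Q| + q ->
  \sum_(x : G) deg x = #|Q| * #|Q|.-1 + 2 * q ->
  (forall W : {set G}, adj_closed W -> {in W, forall x, deg x = 2} -> W = set0) ->
  isomorphic G (kite #|Q| q).
Proof.
move=> kQ cardG sum_deg no2.
have [s [ts s0 s_end]] := tail_exists kQ.
case: (kQ) => cQ v0Q degv0 degQ deg_out; case: (ts) => us sQ ps.
set l := nth v0 (v0 :: s) (size s) in s_end.
have ls : l \in s by rewrite /l -(prednK s0) /= mem_nth // prednK.
have deg_l : deg l <= 1.
  rewrite -(cards1 (nth v0 (v0 :: s) (size s).-1)).
  apply/subset_leq_card/subsetP => y; rewrite in_nbhdT inE.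
  by move=> /s_end ->.
have q0 : 0 < q.
  have := subset_leq_card (subsetT (l |: Q)).
  by rewrite cardsU1 (sQ _ ls) cardsT cardG; lia.
(* Upper bounds for the degrees whose sum is the given degree sum. *)
pose E (x : G) := if x == v0 then #|Q| else if x \in Q then #|Q|.-1 else
            if x == l then 1 else 2.
have leE (x : G) : true -> deg x <= E x ?= iff (deg x == E x).
  move=> _; apply: leqif_eq; rewrite /E; case: eqP => [->|/eqP xv0].
    by rewrite degv0.
  have [xQ|xQ] := boolP (x \in Q); first by rewrite degQ.
  by case: eqP => [->//|_]; have /andP[] := deg_out x xQ.
have sumE : \sum_(x : G) E x = \sum_(x : G) deg x.
  rewrite sum_deg (bigID (mem Q)) /= (bigD1 v0) //= {1}/E eqxx.
  rewrite (eq_bigr (fun=> #|Q|.-1)); last first.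
    by move=> x /andP[xQ xv0]; rewrite /E (negPf xv0) xQ.
  rewrite [X in _ + X](bigD1 l) ?sQ //= {1}/E (negPf (sQ _ ls)) eqxx.
  have -> : (l == v0) = false by apply: contraNF (sQ _ ls) => /eqP->.
  rewrite [X in _ + (_ + X)](eq_bigr (fun=> 2)); last first.
    move=> x /andP[xQ xl]; rewrite /E (negPf xQ) (negPf xl).
    by case: eqP xQ => // ->; rewrite v0Q.
  rewrite !sum_nat_const.
  have -> : #|[pred x | (x \in Q) && (x != v0)]| = #|Q|.-1.
    by rewrite [in RHS](cardsD1 v0 Q) v0Q; apply: eq_card => x; rewrite !inE andbC.
  have -> : #|[pred x | (x \notin Q) && (x != l)]| = q.-1.
    have := cardsC Q; have := cardsD1 l (~: Q); rewrite inE (sQ _ ls) cardG.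
    move=> e1 e2; have -> : q.-1 = #|~: Q :\ l| by lia.
    by apply: eq_card => x; rewrite !inE andbC.
  have : 0 < #|Q| by apply/card_gt0P; exists v0.
  by case: #|Q| => // c _; lia.
have := eq_leqif (leqif_sum leE); rewrite sumE eqxx => /esym/forallP degE.
have memt j : j <= size s -> (nth v0 (v0 :: s) j \in Q) || (nth v0 (v0 :: s) j \in s).
  case: j => [|j] lt_j; first by rewrite v0Q.
  by rewrite /= (mem_nth v0 lt_j) orbT.
have closedM : adj_closed (Q :|: [set x in s]).
  move=> x y; rewrite !inE => /orP[xQ|xs] xy.
    have [ex|xv0] := eqVneq x v0; last first.
      by move: xy; rewrite (clique_inner _ kQ) // => /andP[->].
    move: xy; rewrite ex (clique_root _ kQ (tail_notin ts s0) (tail_step ts s0)).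
    by case/orP=> [/eqP->|/andP[->//]]; apply: memt.
  have [i lt_is ex] : exists2 i, i < size s & x = nth v0 (v0 :: s) i.+1.
    by exists (index x s); rewrite ?index_mem //= nth_index.
  have [lt_i1s|le_si1] := ltnP i.+1 (size s).
    move: xy; rewrite ex (tail_inner kQ ts) // => /orP[]/eqP->; apply: memt => //.
    exact: ltnW.
  have ei : size s = i.+1 by lia.
  by move: xy; rewrite ex -ei => /s_end ->; apply: memt; rewrite leq_pred.
have MT : ~: (Q :|: [set x in s]) = set0.
  apply: no2; first exact: adj_closedC.
  move=> x; rewrite !inE negb_or => /andP[xQ xs].
  have := degE x; rewrite /E (negPf xQ).
  have -> : (x == v0) = false by apply: contraNF xQ => /eqP->.
  have -> : (x == l) = false by apply: contraNF xs => /eqP->.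
  by move/eqP.
have sz : size s = q.
  have := cardsCs (Q :|: [set x in s]); rewrite MT cards0 subn0 cardG cardsU.
  have -> : Q :&: [set x in s] = set0.
    apply/setP => x; rewrite !inE; apply/negP => /andP[xQ] /sQ.
    by rewrite xQ.
  by rewrite cards0 subn0 cardsE (card_uniqP us); lia.
rewrite -sz; apply: isomorphic_inj (unfold_kite_inj kQ ts) _ _.
  by rewrite card_sum !card_ord cardG sz.
exact: unfold_kite_adj.
Qed.

(** * Counts in a kite *)

Lemma triads_clique (G : sgraph) (Q : {set G}) : clique Q ->
  #|Q| * (#|Q|.-1 * #|Q|.-2) <= triads [set: G].
Proof.
move=> cQ; rewrite /triads -sum_nat_const.
rewrite [X in _ <= X](big_setID Q) setTI /=; apply: leq_trans (leq_addr _ _).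
apply: leq_sum => x xQ; rewrite -[X in X * _](_ : #|Q :\ x| = _); last first.
  by rewrite (cardsD1 x Q) xQ.
rewrite -sum_nat_const [X in _ <= X](big_setID (Q :\ x)) setTI /=.
apply: leq_trans (leq_addr _ _); apply: leq_sum => y; rewrite !inE => /andP[yx yQ].
have -> : #|Q|.-2 = #|Q :\ x :\ y|.
  by rewrite (cardsD1 x Q) xQ (cardsD1 y (Q :\ x)) !inE yx yQ.
rewrite -sum1_card [X in _ <= X](big_setID (Q :\ x :\ y)) setTI /=.
apply: leq_trans (leq_addr _ _); apply: leq_sum => z; rewrite !inE => /and3P[zy zx zQ].
by rewrite !cQ // eq_sym.
Qed.

Lemma triads_triangle (G : sgraph) : 0 < triads [set: G] ->
  exists2 Q : {set G}, clique Q & #|Q| = 3.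
Proof.
rewrite lt0n; rewrite /triads sum_nat_eq0 negb_forall_in => /exists_inP[x _].
rewrite sum_nat_eq0 negb_forall_in => /exists_inP[y _].
rewrite sum_nat_eq0 negb_forall_in => /exists_inP[z _].
rewrite !muln_eq0 !eqb0 !negb_or !negbK => /andP[/andP[xy yz] zx].
have neq (u v : G) : adj u v -> u != v by apply: contraTneq => ->; rewrite adj_irrefl.
exists [set x; y; z]; last first.
  rewrite setUC !cardsU1 cards1 !inE negb_or (neq z x) // (eq_sym z).
  by rewrite (neq y z) // (neq x y).
move=> u v; rewrite !inE.
move=> /orP[/orP[]|]/eqP-> /orP[/orP[]|]/eqP->; rewrite ?eqxx // => _;
  by rewrite // adj_sym.
Qed.

Lemma sum_eq_ord q k : \sum_(j < q) (j == k :> nat) = (k < q).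
Proof.
have [lt_kq|le_qk] := ltnP k q; last first.
  by rewrite big1 // => j _; rewrite ltn_eqF //; apply: leq_trans le_qk.
rewrite (bigD1 (Ordinal lt_kq)) //= eqxx big1 // => j jk.
by case: eqP => // e; case/eqP: jk; apply: val_inj.
Qed.

Section KiteCounts.

Variables (p q : nat).
Local Notation K := (kite p.+1 q).
Hypothesis q0 : 0 < q.

Lemma kite_degl (i : 'I_p.+1) : deg (inl i : K) = p + (i == ord0).
Proof.
rewrite degE big_sumType /=; congr (_ + _).
  rewrite (bigD1 i) //= eqxx add0n (eq_bigr (fun=> 1)) ?sum1_card.
    by rewrite (cardC1 i) card_ord.
  by move=> j ji; rewrite eq_sym ji.
rewrite /kite_adj -(inj_eq val_inj) /=; case: eqP => [_|_]; last by rewrite big1.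
by rewrite sum_eq_ord q0.
Qed.

Lemma kite_degr (j : 'I_q) : deg (inr j : K) = 1 + (j.+1 < q).
Proof.
rewrite degE big_sumType /= /kite_adj.
have -> : \sum_(i < p.+1) ((i == 0 :> nat) && (j == 0 :> nat)) = (j == 0 :> nat).
  by rewrite big_ord_recl /= big1 ?addn0.
have -> : \sum_(l < q) ((j.+1 == l) || (l.+1 == j)) =
    \sum_(l < q) (l == j.+1 :> nat) + \sum_(l < q) (l.+1 == j).
  rewrite -big_split; apply: eq_bigr => l _ /=; rewrite [j.+1 == l]eq_sym.
  by case: eqP => //= ->; rewrite gtn_eqF.
rewrite sum_eq_ord addnCA addnC; congr (_ + _).
case: (nat_of_ord j) (ltn_ord j) => [|k] lt_k; first by rewrite big1.
by rewrite (sum_eq_ord q k) ltnW.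
Qed.

Lemma kite_sum_deg (F : nat -> nat) :
  \sum_(x : K) F (deg x) = F p.+1 + p * F p + (q.-1 * F 2 + F 1).
Proof.
rewrite big_sumType /= big_ord_recl kite_degl eqxx addn1; congr (_ + _ + _).
  rewrite (eq_bigr (fun=> F p)) ?sum_nat_const ?card_ord // => i _.
  by rewrite kite_degl lift_eqF addn0.
have lt_q1 : q.-1 < q by rewrite prednK.
rewrite (bigD1 (Ordinal lt_q1)) //= kite_degr /= prednK // ltnn addn0 addnC.
congr (_ + _); rewrite (eq_bigr (fun=> F 2)) => [|j jq].
  by rewrite sum_nat_const (cardC1 (Ordinal lt_q1)) card_ord.
rewrite kite_degr; suff -> : j.+1 < q by [].
rewrite ltn_neqAle ltn_ord andbT; apply: contra jq => /eqP e.
by apply/eqP/val_inj => /=; lia.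
Qed.

Lemma kite_codeg_rim (x y : 'I_p.+1) : x != y ->
  codeg (inl x : K) (inl y) <= p.-1.
Proof.
move=> xy; rewrite codegE.
have -> : p.-1 = #|[set (inl i : K) | i in [set~ x] :\ y]|.
  rewrite card_imset => [|i j []//].
  have := cardsD1 y [set~ x]; rewrite !inE eq_sym xy cardsC1 card_ord /=; lia.
apply/subset_leq_card/subsetP => -[i|k]; rewrite !inE /kite_adj.
  move=> /andP[xi iy]; apply/imsetP; exists i => //.
  by move: xi iy; rewrite !inE /= [i == x]eq_sym => -> ->.
move=> /andP[/andP[x0 _] /andP[y0 _]]; case/eqP: xy.
by apply: val_inj; rewrite /= (eqP x0) (eqP y0).
Qed.

(** Outside the clique a kite is a tree, so it has no further 4-cycle. *)
Lemma kite_codeg_other (x y : K) : x != y ->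
  ~~ (if x is inl _ then if y is inl _ then true else false else false) ->
  codeg x y <= 1.
Proof.
move=> xy nxy; rewrite codegE; apply/card_le1_eqP => z z'; rewrite !inE.
have {}xy : if x is inr i then if y is inr j then i != j :> nat else true else true.
  by case: x y xy {nxy} => [?|i] [?|j] //; apply: contraNneq => /val_inj->.
case: x y xy nxy => [x|x] [y|y] // xy _; case: z => [z|z]; case: z' => [z'|z'];
  rewrite /kite_adj //= => /andP[h1 h2] /andP[h3 h4];
  first [ by exfalso; lia | by congr inl; apply: val_inj => /=; lia
        | by congr inr; apply: val_inj => /=; lia].
Qed.

Lemma kite_walks4 :
  walks4 K + \sum_(x : K) deg x <=
    2 * (\sum_(x : K) deg x ^ 2) + p.+1 * (p * (p.-1 * p.-1.-1)).
Proof.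
rewrite walks4E leq_add2l big_sumType /=.
rewrite [X in _ + X]big1 => [|x _]; last first.
  rewrite big1 // => y yx; have := @kite_codeg_other (inr x) y.
  by rewrite eq_sym => /(_ yx isT); case: codeg => [|[|]].
rewrite addn0 -[X in X * _](card_ord p.+1) -sum_nat_const; apply: leq_sum => x _.
rewrite big_sumType /= [X in _ + X]big1 => [|y yx]; last first.
  have := @kite_codeg_other (inl x) (inr y).
  by move=> /(_ isT isT); case: codeg => [|[|]].
rewrite addn0 -[X in X * _](_ : #|[pred y : 'I_p.+1 | (inl y : K) != inl x]| = _).
  rewrite -sum_nat_const; apply: leq_sum => y yx.
  have := @kite_codeg_rim x y; rewrite eq_sym => /(_ yx).
  by move=> le_c; have := leq_mul le_c (leq_sub2r 1 le_c); rewrite !subn1.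
apply: etrans (_ : #|predC1 x| = p); first exact: eq_card.
by rewrite cardC1 card_ord.
Qed.

Lemma kite_clique : exists2 Q : {set K}, clique Q & #|Q| = p.+1.
Proof.
exists [set (inl i : K) | i in 'I_p.+1]; last first.
  by rewrite card_imset ?card_ord // => i j [].
by move=> _ _ /imsetP[i _ ->] /imsetP[j _ ->].
Qed.

Lemma kite_arcs : arcs [set: K] = p.+1 * p + 2 * q.
Proof. by rewrite arcsT (kite_sum_deg id); case: q q0 => // q' _; lia. Qed.

Lemma kite_excess :
  \sum_(x : K) excess (deg x) = excess p.+1 + p * excess p.
Proof.
by rewrite kite_sum_deg (_ : excess 2 = 0) // (_ : excess 1 = 0) // muln0 !addn0.
Qed.

End KiteCounts.

(** * Spectral decomposition of the adjacency matrix *)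

Import Order.TTheory GRing.Theory Num.Theory.
Local Open Scope ring_scope.
Local Open Scope sesquilinear_scope.

(** Real symmetric matrices are unitarily diagonalisable, which makes algebraic
    and geometric multiplicities agree. *)
Lemma adjacency_hermitian (G : sgraph) : adjacency_mx G \is hermsymmx.
Proof.
apply: realsym_hermsym.
  apply/is_hermitianmxP; rewrite expr0 scale1r map_mx_id //.
  by apply/matrixP => i j; rewrite !mxE adj_sym.
by apply/mxOverP => i j; rewrite mxE realn.
Qed.

(** The characteristic matrices are conjugate over the polynomials. *)
Lemma char_poly_conj (F : fieldType) n (P A : 'M[F]_n) : P \in unitmx ->
  char_poly (invmx P *m A *m P) = char_poly A.
Proof.
move=> uP; rewrite /char_poly /char_poly_mx.
have uPC : map_mx polyC P \in unitmx by rewrite map_unitmx.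
have -> : 'X%:M - map_mx polyC (invmx P *m A *m P) =
   invmx (map_mx polyC P) *m ('X%:M - map_mx polyC A) *m map_mx polyC P.
  rewrite mulmxBr mulmxBl !map_mxM map_invmx; congr (_ - _).
  by rewrite scalar_mxC -mulmxA mulVmx // mulmx1.
by rewrite !det_mulmx mulrC mulrA -det_mulmx mulmxV // det1 mul1r.
Qed.

Notation eigenval G := (spectral_diag (adjacency_mx G) 0).

(** The orthonormal basis of eigenfunctions given by the spectral theorem, with
    vertices as arguments instead of matrix indices. *)
Definition basis_fun (G : sgraph) (i : 'I_#|G|) (x : G) : algC :=
  spectralmx (adjacency_mx G) i (enum_rank x).

Definition eigenfun (G : sgraph) (a : algC) (f : G -> algC) : Prop :=
  forall x, \sum_(y : G) (adj x y)%:R * f y = a * f x.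

Lemma adjacency_spectral (G : sgraph) :
  adjacency_mx G = invmx (spectralmx (adjacency_mx G))
    *m diag_mx (spectral_diag (adjacency_mx G)) *m spectralmx (adjacency_mx G).
Proof. exact/orthomx_spectralP/hermitian_normalmx/adjacency_hermitian. Qed.

Lemma eigenval_real (G : sgraph) i : eigenval G i \is Num.real.
Proof.
by have /mxOverP := hermitian_spectral_diag_real (adjacency_hermitian G); apply.
Qed.

Lemma spectrum_eigenval (G : sgraph) :
  perm_eq (spectrum (adjacency_mx G)) [seq eigenval G i | i <- enum 'I_#|G|].
Proof.
apply: prod_XsubC_eq; rewrite -spectrumE {1}adjacency_spectral.
rewrite char_poly_conj ?spectral_unit // char_poly_trig ?diag_mx_is_trig //.
by rewrite big_map big_enum; apply: eq_bigr => i _; rewrite mxE eqxx.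
Qed.

Lemma sum_spectrum (G : sgraph) (F : algC -> algC) :
  \sum_(z <- spectrum (adjacency_mx G)) F z = \sum_i F (eigenval G i).
Proof. by rewrite (perm_big _ (spectrum_eigenval G)) big_map big_enum. Qed.

Lemma sum_enum_val (T : finType) (R : nmodType) (F : T -> R) :
  \sum_(i < #|T|) F (enum_val i) = \sum_x F x.
Proof. by rewrite -big_enum_val; apply: eq_bigl => x. Qed.

Lemma eigenvalueE (G : sgraph) (a : algC) :
  reflect (exists2 f, eigenfun a f & exists x : G, f x != 0)
          (eigenvalue (adjacency_mx G) a).
Proof.
apply: (iffP eigenvalueP) => [[v Av nz_v]|[f Af [x fx]]].
  exists (fun x => v 0 (enum_rank x)).
    move=> x; have /rowP/(_ (enum_rank x)) := Av; rewrite !mxE => <-.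
    rewrite -[LHS]sum_enum_val; apply: eq_bigr => i _.
    by rewrite mxE enum_valK enum_rankK adj_sym mulrC.
  have [i vi] : exists i, v 0 i != 0.
    apply/existsP; apply: contraNT nz_v; rewrite negb_exists => /forallP v0.
    by apply/eqP/rowP => i; rewrite mxE; apply/eqP/negPn/v0.
  by exists (enum_val i); rewrite enum_valK.
exists (\row_i f (enum_val i)).
  apply/rowP => i; rewrite !mxE -Af -[RHS]sum_enum_val; apply: eq_bigr => j _.
  by rewrite !mxE adj_sym mulrC.
by apply: contraNneq fx => /rowP/(_ (enum_rank x)); rewrite !mxE enum_rankK => ->.
Qed.

Lemma basis_eigenfun (G : sgraph) i :
  eigenfun (eigenval G i) (@basis_fun G i).
Proof.
set P := spectralmx (adjacency_mx G).
have PA : P *m adjacency_mx G = diag_mx (spectral_diag (adjacency_mx G)) *m P.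
  by rewrite {1}adjacency_spectral -mulmxA mulKVmx ?spectral_unit.
move=> x; have /matrixP/(_ i (enum_rank x)) := PA.
rewrite mul_diag_mx !mxE => <-; rewrite -[LHS]sum_enum_val; apply: eq_bigr => j _.
by rewrite mxE /basis_fun enum_valK enum_rankK adj_sym mulrC.
Qed.

Lemma basis_ortho (G : sgraph) i j :
  \sum_x @basis_fun G i x * (@basis_fun G j x)^* = (i == j)%:R.
Proof.
have /unitarymxP/matrixP/(_ i j) := spectral_unitarymx (adjacency_mx G).
rewrite !mxE => <-; rewrite -[LHS]sum_enum_val; apply: eq_bigr => k _.
by rewrite !mxE /basis_fun enum_valK.
Qed.

Lemma basis_complete (G : sgraph) x y :
  \sum_i @basis_fun G i x * (@basis_fun G i y)^* = (x == y)%:R.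
Proof.
set P := spectralmx (adjacency_mx G).
have PP : P^t* *m P = 1%:M.
  by rewrite -invmx_unitary ?spectral_unitarymx // mulVmx ?spectral_unit.
have /matrixP/(_ (enum_rank y) (enum_rank x)) := PP.
rewrite !mxE (inj_eq enum_rank_inj) eq_sym => <-.
by apply: eq_bigr => i _; rewrite !mxE mulrC.
Qed.

(** The eigenfunctions span, so they do not all vanish at x. *)
Lemma eigenfun_through (G : sgraph) (x : G) :
  exists a f, eigenfun a f /\ f x != 0.
Proof.
have [i fi] : exists i, @basis_fun G i x != 0.
  apply/existsP; apply: contraTT (oner_neq0 algC); rewrite negb_exists negbK.
  have <- : \sum_i @basis_fun G i x * (@basis_fun G i x)^* = 1.
    by rewrite basis_complete eqxx.
  move/forallP => f0; rewrite big1 // => i _.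
  by have /negPn/eqP-> := f0 i; rewrite mul0r.
by exists (eigenval G i), (@basis_fun G i); split=> //; apply: basis_eigenfun.
Qed.

Definition eig_coord (G : sgraph) (f : G -> algC) (i : 'I_#|G|) : algC :=
  \sum_x f x * (basis_fun i x)^*.

Lemma coord_sum (G : sgraph) (f : G -> algC) x :
  f x = \sum_i eig_coord f i * basis_fun i x.
Proof.
under eq_bigr => i _ do rewrite mulr_suml.
rewrite exchange_big /= (bigD1 x) //= [X in _ + X]big1 ?addr0 => [|y yx].
  under eq_bigr => i _ do rewrite -mulrA (mulrC (_^*)).
  by rewrite -mulr_sumr basis_complete eqxx mulr1.
under eq_bigr => i _ do rewrite -mulrA (mulrC (_^*)).
by rewrite -mulr_sumr basis_complete eq_sym (negPf yx) mulr0.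
Qed.

Definition adj_form (G : sgraph) (f : G -> algC) : algC :=
  \sum_x (\sum_y (adj x y)%:R * f y) * (f x)^*.

Lemma parseval (G : sgraph) (f g : G -> algC) :
  \sum_x f x * (g x)^* = \sum_i eig_coord f i * (eig_coord g i)^*.
Proof.
under eq_bigr => x _ do rewrite (coord_sum f) mulr_suml.
rewrite exchange_big /=; apply: eq_bigr => i _.
have -> : (eig_coord g i)^* = \sum_x (g x)^* * basis_fun i x.
  rewrite rmorph_sum; apply: eq_bigr => x _.
  by rewrite rmorphM /= conjCK.
rewrite mulr_sumr; apply: eq_bigr => x _.
by rewrite -mulrA (mulrC (basis_fun i x)).
Qed.

Lemma coord_adj (G : sgraph) (f : G -> algC) i :
  eig_coord (fun x => \sum_y (adj x y)%:R * f y) i = eigenval G i * eig_coord f i.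
Proof.
rewrite /eig_coord; under eq_bigr => x _ do rewrite mulr_suml.
rewrite exchange_big mulr_sumr /=; apply: eq_bigr => y _.
rewrite mulrCA -(CrealP (eigenval_real i)) -rmorphM -basis_eigenfun rmorph_sum mulr_sumr.
apply: eq_bigr => x _.
by rewrite rmorphM /= conjC_nat adj_sym mulrCA mulrA.
Qed.

Lemma adj_formE (G : sgraph) (f : G -> algC) :
  adj_form f = \sum_i eigenval G i * `|eig_coord f i| ^+ 2.
Proof.
rewrite /adj_form parseval; apply: eq_bigr => i _.
by rewrite coord_adj -mulrA normCK.
Qed.

Lemma sqnormE (G : sgraph) (f : G -> algC) :
  \sum_x `|f x| ^+ 2 = \sum_i `|eig_coord f i| ^+ 2.
Proof.
under eq_bigr do rewrite normCK; rewrite parseval.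
by apply: eq_bigr => i _; rewrite normCK.
Qed.

Lemma trace_conj (F : fieldType) n (P X : 'M[F]_n) : P \in unitmx ->
  \tr (invmx P *m X *m P) = \tr X.
Proof. by move=> uP; rewrite mxtrace_mulC mulmxA mulmxV // mul1mx. Qed.

Lemma mul_conj (F : fieldType) n (P X Y : 'M[F]_n) : P \in unitmx ->
  (invmx P *m X *m P) *m (invmx P *m Y *m P) = invmx P *m (X *m Y) *m P.
Proof. by move=> uP; rewrite !mulmxA mulmxK. Qed.

Lemma trace_diag_conj (F : fieldType) n (P : 'M[F]_n) (d : 'rV_n) :
  P \in unitmx -> let A := invmx P *m diag_mx d *m P in
  [/\ \tr (A *m A) = \sum_i d 0 i ^+ 2, \tr (A *m A *m A) = \sum_i d 0 i ^+ 3 &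
      \tr ((A *m A) *m (A *m A)) = \sum_i d 0 i ^+ 4].
Proof.
move=> uP A; rewrite !mul_conj // !trace_conj // !mulmx_diag !mxtrace_diag.
by split; apply: eq_bigr => i _; rewrite !mxE !exprS expr0 mulr1 ?mulrA.
Qed.

Lemma trace_sqr (G : sgraph) :
  \sum_i eigenval G i ^+ 2 = (arcs [set: G])%:R.
Proof.
set A := adjacency_mx G; have uP := spectral_unit A.
transitivity (\tr (A *m A)).
  by have [] := trace_diag_conj (spectral_diag A) uP; rewrite -adjacency_spectral.
rewrite /mxtrace (eq_bigr (fun i => \sum_y ((adj (enum_val i) y)%:R : algC))).
  rewrite (sum_enum_val (fun x => \sum_y (adj x y)%:R)) arcsT natr_sum.
  by apply: eq_bigr => x _; rewrite degE natr_sum.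
move=> i _; rewrite mxE -[RHS]sum_enum_val; apply: eq_bigr => j _.
by rewrite !mxE (adj_sym (enum_val j)) -natrM mulnb andbb.
Qed.

Lemma trace_cube (G : sgraph) :
  \sum_i eigenval G i ^+ 3 = (triads [set: G])%:R.
Proof.
set A := adjacency_mx G; have uP := spectral_unit A.
transitivity (\tr (A *m A *m A)).
  by have [] := trace_diag_conj (spectral_diag A) uP; rewrite -adjacency_spectral.
have -> : triads [set: G] =
    (\sum_(x : G) \sum_(z : G) \sum_(y : G) adj x y * adj y z * adj z x)%N.
  rewrite /triads; apply: eq_big => [x|x _]; first by rewrite inE.
  rewrite exchange_big; apply: eq_big => [z|z _]; first by rewrite inE.
  by apply: eq_big => [y|y _]; first by rewrite inE.
rewrite natr_sum -[RHS]sum_enum_val; apply: eq_bigr => i _.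
rewrite mxE natr_sum -[RHS]sum_enum_val; apply: eq_bigr => j _.
rewrite mxE natr_sum -[RHS]sum_enum_val mulr_suml; apply: eq_bigr => k _.
by rewrite !mxE -!natrM.
Qed.

Lemma trace_fourth (G : sgraph) :
  \sum_i eigenval G i ^+ 4 = (walks4 G)%:R.
Proof.
set A := adjacency_mx G; have uP := spectral_unit A.
transitivity (\tr ((A *m A) *m (A *m A))).
  by have [] := trace_diag_conj (spectral_diag A) uP; rewrite -adjacency_spectral.
have AA i j : (A *m A) i j = (codeg (enum_val i) (enum_val j))%:R.
  rewrite mxE /codeg natr_sum -[RHS]sum_enum_val; apply: eq_bigr => k _.
  by rewrite !mxE -natrM.
rewrite natr_sum -[RHS]sum_enum_val; apply: eq_bigr => i _.
rewrite mxE natr_sum -[RHS]sum_enum_val; apply: eq_bigr => j _.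
rewrite !AA -natrM; congr (_%:R); rewrite expnS expn1; congr (_ * _)%N.
by rewrite /codeg; apply: eq_bigr => z _; rewrite mulnC; congr (_ * _)%N; rewrite adj_sym.
Qed.

Lemma same_spectrum_moments (G H : sgraph) : same_spectrum G H ->
  [/\ #|G| = #|H|, arcs [set: G] = arcs [set: H],
      triads [set: G] = triads [set: H] & walks4 G = walks4 H].
Proof.
move=> GH; have sum_eq (F : algC -> algC) :
    \sum_i F (eigenval G i) = \sum_i F (eigenval H i).
  by rewrite -!sum_spectrum; apply: perm_big.
split; apply/eqP.
- have := sum_eq (fun=> 1); rewrite !sumr_const !card_ord => /eqP.
  by rewrite eqr_nat.
- by have /eqP := sum_eq (fun z => z ^+ 2); rewrite !trace_sqr eqr_nat.
- by have /eqP := sum_eq (fun z => z ^+ 3); rewrite !trace_cube eqr_nat.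
- by have /eqP := sum_eq (fun z => z ^+ 4); rewrite !trace_fourth eqr_nat.
Qed.

Lemma same_spectrum_eigenvalue (G H : sgraph) a : same_spectrum G H ->
  eigenvalue (adjacency_mx G) a = eigenvalue (adjacency_mx H) a.
Proof. by move=> GH; rewrite -!mem_spectrum (perm_mem GH). Qed.

(** An eigenfunction that does not vanish somewhere on S restricts to the union
    of components S; changing its sign on one colour class negates the
    eigenvalue. *)
Lemma bipartite_symmetric (G : sgraph) (S : {set G}) (c : G -> bool) (x : G) :
  adj_closed S -> x \in S -> {in S &, forall u v, adj u v -> c u != c v} ->
  exists2 a, eigenvalue (adjacency_mx G) a & eigenvalue (adjacency_mx G) (- a).
Proof.
move=> cS xS cP; have [a [f [Af fx]]] := eigenfun_through x; exists a.
  by apply/eigenvalueE; exists f => //; exists x.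
apply/eigenvalueE; exists (fun y => if y \in S then (-1) ^+ c y * f y else 0).
  move=> y; have [yS|yS] := boolP (y \in S); last first.
    rewrite mulr0 big1 // => z _; case: ifP => zS; last by rewrite mulr0.
    case yz: (adj y z); last by rewrite mul0r.
    by have := adj_closedC cS; move=> /(_ y z); rewrite !inE yS yz zS => /(_ isT isT).
  rewrite mulrCA mulNr -Af mulrN mulr_sumr -sumrN; apply: eq_bigr => z _.
  case yz: (adj y z); last by rewrite !mul0r mulr0 oppr0.
  have zS := cS y z yS yz; rewrite zS !mul1r -mulNr; congr (_ * _).
  by have := cP y z yS zS yz; case: (c y); case: (c z) => //; rewrite expr0 expr1 ?opprK.
by exists x; rewrite xS mulf_neq0 // signr_eq0.
Qed.

(** * Eigenvalues at least two, and connectedness *)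

(** Counted with multiplicity. *)
Definition large_eigenvalues (G : sgraph) : nat :=
  count (fun z => 2 <= z) (spectrum (adjacency_mx G)).

Lemma large_eigenvaluesE (G : sgraph) :
  large_eigenvalues G = #|[set i | 2 <= eigenval G i]|.
Proof.
rewrite /large_eigenvalues (permP (spectrum_eigenval G)) count_map.
by rewrite -sum1_count -sum1_card big_enum_cond /=; apply: eq_bigl => i; rewrite !inE.
Qed.

(** The form of 2 - A in spectral coordinates. *)
Lemma gap_formE (G : sgraph) (f : G -> algC) :
  2 * (\sum_x `|f x| ^+ 2) - adj_form f =
  \sum_i (2 - eigenval G i) * `|eig_coord f i| ^+ 2.
Proof.
rewrite sqnormE adj_formE mulr_sumr -sumrB; apply: eq_bigr => i _.
by rewrite mulrBl.
Qed.

(** The indicators of S and T span a plane on which 2 - A is nonpositive. If only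
    one eigenvalue were at least 2, the plane would contain a nonzero function
    orthogonal to its eigenfunction, where 2 - A is positive. *)
Lemma large_eigenvalues_ge2 (G : sgraph) (S T : {set G}) :
  adj_closed S -> adj_closed T -> [disjoint S & T] -> S != set0 -> T != set0 ->
  (2 * #|S| <= arcs S)%N -> (2 * #|T| <= arcs T)%N ->
  (1 < large_eigenvalues G)%N.
Proof.
move=> cS cT ST S0 T0 leS leT; rewrite ltnNge large_eigenvaluesE; apply/negP => le1.
have [i0 lt2] : exists i0, forall i, i != i0 -> eigenval G i < 2.
  have lt2 i : i \notin [set i | 2 <= eigenval G i] -> eigenval G i < 2.
    by rewrite inE -real_ltNge ?eigenval_real ?realn.
  have [e0|[i ei]] := set_0Vmem [set i | 2 <= eigenval G i].
    have /set0Pn[x _] := S0; exists (enum_rank x) => i _.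
    by apply: lt2; rewrite e0 inE.
  exists i => j ji; apply: lt2; apply: contra ji => ej.
  by apply/eqP; move: le1 => /card_le1_eqP; apply.
pose ind (U : {set G}) (x : G) : algC := (x \in U)%:R.
(* A combination of the two indicators orthogonal to the eigenfunction i0. *)
have [a [b [ab cab]]] : exists a b : algC, ((a != 0) || (b != 0)) /\
    a * eig_coord (ind S) i0 + b * eig_coord (ind T) i0 = 0.
  have [c0|c0] := eqVneq (eig_coord (ind S) i0) 0.
    by exists 1, 0; rewrite oner_neq0 c0; split=> //; ring.
  exists (- eig_coord (ind T) i0), (eig_coord (ind S) i0); rewrite c0 orbT; split=> //; ring.
pose f x := a * ind S x + b * ind T x.
have f0 : eig_coord f i0 = 0.
  rewrite -cab /eig_coord !mulr_sumr -big_split; apply: eq_bigr => x _.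
  by rewrite /f /=; ring.
have closed_eq (U : {set G}) x y : adj_closed U -> adj x y -> (x \in U) = (y \in U).
  move=> cU xy; apply/idP/idP => h; apply: (cU _ _ h) => //.
  by rewrite adj_sym.
have notST x : (x \in S) && (x \in T) = false.
  by apply/negP => /andP[xS]; rewrite (disjointFr ST xS).
have cardE (U : {set G}) : \sum_(x : G) (x \in U)%:R = #|U|%:R :> algC.
  by rewrite -natr_sum -sum1_card [in RHS]big_mkcond.
have arcsE (U : {set G}) :
    (arcs U)%:R = \sum_x \sum_y ((x \in U) && (y \in U) && adj x y)%:R :> algC.
  rewrite /arcs big_mkcond natr_sum; apply: eq_bigr => x _.
  case: (x \in U); last by rewrite big1.
  rewrite big_mkcond natr_sum; apply: eq_bigr => y _.
  by case: (y \in U).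
have sqnorm_f : \sum_x `|f x| ^+ 2 = `|a| ^+ 2 * #|S|%:R + `|b| ^+ 2 * #|T|%:R.
  rewrite -!cardE !mulr_sumr -big_split; apply: eq_bigr => x _ /=.
  have := notST x; rewrite /f /ind; case: (x \in S); case: (x \in T) => // _;
    by rewrite ?mulr1 ?mulr0 ?addr0 ?add0r // normr0 expr0n.
have form_f : adj_form f = `|a| ^+ 2 * (arcs S)%:R + `|b| ^+ 2 * (arcs T)%:R.
  rewrite /adj_form !arcsE !mulr_sumr -big_split; apply: eq_bigr => x _ /=.
  rewrite mulr_suml !mulr_sumr -big_split; apply: eq_bigr => y _ /=.
  case xy: (adj x y); last by rewrite !andbF !mul0r !mulr0 addr0.
  rewrite /f /ind -(closed_eq _ _ _ cS xy) -(closed_eq _ _ _ cT xy) !andbb !andbT.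
  have := notST x; case: (x \in S); case: (x \in T) => // _;
    by rewrite !(mulr1, mulr0, addr0, add0r, mul1r) ?mul0r // normCK.
have [x fx] : exists x, f x != 0.
  case/orP: ab => [a0|b0].
    have [x xS] := set0Pn _ S0; exists x; have := notST x.
    by rewrite /f /ind xS /= => ->; rewrite mulr1 mulr0 addr0.
  have [x xT] := set0Pn _ T0; exists x; have := notST x.
  by rewrite /f /ind xT andbT => ->; rewrite mulr1 mulr0 add0r.
have ge0 i : true -> 0 <= (2 - eigenval G i) * `|eig_coord f i| ^+ 2.
  move=> _; have [->|ii0] := eqVneq i i0; first by rewrite f0 normr0 expr0n mulr0.
  by rewrite mulr_ge0 ?exprn_ge0 // subr_ge0 ltW ?lt2.
have := gap_formE f; rewrite sqnorm_f form_f => eq_sum.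
have sum0 : \sum_i (2 - eigenval G i) * `|eig_coord f i| ^+ 2 = 0.
  apply/eqP; rewrite eq_le sumr_ge0 // andbT -eq_sum.
  have -> : 2 * (`|a| ^+ 2 * #|S|%:R + `|b| ^+ 2 * #|T|%:R)
      - (`|a| ^+ 2 * (arcs S)%:R + `|b| ^+ 2 * (arcs T)%:R) =
      - (`|a| ^+ 2 * ((arcs S)%:R - (2 * #|S|)%:R)
         + `|b| ^+ 2 * ((arcs T)%:R - (2 * #|T|)%:R)) :> algC.
    by rewrite !natrM; ring.
  by rewrite oppr_le0 addr_ge0 // mulr_ge0 ?exprn_ge0 // subr_ge0 ler_nat.
case/eqP: fx; rewrite coord_sum big1 // => i _.
have [->|ii0] := eqVneq i i0; first by rewrite f0 mul0r.
move/eqP: sum0; rewrite psumr_eq0 // => /allP/(_ i (mem_index_enum _)).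
rewrite mulf_eq0 subr_eq0 gt_eqF ?lt2 //= expf_eq0 /= normr_eq0 => /eqP->.
by rewrite mul0r.
Qed.

(** Without the pair a, - a no component is a tree, so each component has as many
    edges as vertices; two of them would give two large eigenvalues. *)
Lemma spectrum_connected (G : sgraph) :
  (0 < #|G|)%N ->
  (forall a, eigenvalue (adjacency_mx G) a -> ~~ eigenvalue (adjacency_mx G) (- a)) ->
  (large_eigenvalues G <= 1)%N -> grown [set: G].
Proof.
move=> /card_gt0P[x0 _] asym le1; have [S [gS xS cS]] := grown_closure x0.
have cyclic (U : {set G}) : grown U -> adj_closed U -> (2 * #|U| <= arcs U)%N.
  move=> gU cU; rewrite leqNgt; apply/negP => /(grown_tree_bipartite gU)[c cP].
  have [u uU] := set0Pn _ (grown_neq0 gU).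
  by have [a aA] := bipartite_symmetric cU uU cP; rewrite (negPf (asym a aA)).
have [->//|SnT] := eqVneq [set: G] S.
have [y yS] : exists y, y \notin S.
  apply/existsP; apply: contraNT SnT; rewrite negb_exists => /forallP allS.
  by apply/eqP/setP => y; rewrite inE; apply/esym/negPn/allS.
have [T [gT yT cT]] := grown_closure y.
have sTS : T \subset ~: S.
  by case: (grown_in_closed gT cS) => // /subsetP/(_ y yT); rewrite (negPf yS).
have dST : [disjoint S & T] by rewrite disjoint_sym disjoints_subset.
have := large_eigenvalues_ge2 cS cT dST (grown_neq0 gS) (grown_neq0 gT)
  (cyclic _ gS cS) (cyclic _ gT cT).
by rewrite ltnNge le1.
Qed.

(** * The spectrum of a kite *)

Section KiteVectors.

Variables (p q : nat).
Local Notation K := (kite p.+1 q).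
Variable f : K -> algC.

(** Values along the tail, with the junction at 0 and the value 0 beyond the end, so
    that the eigenvalue equation is the same recurrence at every tail vertex. *)
Definition tail_value (k : nat) : algC :=
  if k is j.+1 then (if insub j is Some i then f (inr i) else 0)
  else f (inl ord0).

Definition rim_sum : algC := \sum_(i < p) f (inl (lift ord0 i)).

Lemma tail_valueS (i : 'I_q) : tail_value i.+1 = f (inr i).
Proof. by rewrite /= valK. Qed.

Lemma tail_value_end : tail_value q.+1 = 0.
Proof. by rewrite /= insubF // ltnn. Qed.

(** The action of the adjacency matrix; at a clique vertex other than the junction,
    the whole clique is summed and the vertex itself removed. *)
Lemma kite_actionE (v : K) :
  \sum_(w : K) (adj v w)%:R * f w =
  match v with
  | inl i => if i == ord0 then rim_sum + tail_value 1
             else tail_value 0 + rim_sum - f (inl i)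
  | inr k => tail_value k + tail_value k.+2
  end.
Proof.
rewrite big_sumType /= big_ord_recl.
have pick (P : pred 'I_q) (k : nat) : (forall j, P j = (j == k :> nat)) ->
    \sum_j (P j)%:R * f (inr j) = tail_value k.+1.
  move=> Pk /=; case: insubP => [i _ ei|].
    rewrite (bigD1 i) //= Pk ei eqxx mul1r big1 ?addr0 // => j ji.
    rewrite Pk -ei; case: eqP => [/val_inj ej|_]; last by rewrite mul0r.
    by rewrite ej eqxx in ji.
  rewrite -leqNgt => le_qk; rewrite big1 // => j _.
  by rewrite Pk ltn_eqF ?mul0r //; apply: leq_trans (ltn_ord j) le_qk.
case: v => [i|k] /=.
  case: eqP => [->|/eqP i0].
    rewrite /kite_adj /= mul0r add0r (pick _ 0%N) //; congr (_ + _).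
    by apply: eq_bigr => j _; rewrite mul1r.
  rewrite /kite_adj /= mul1r -!addrA; congr (_ + _).
  rewrite [X in _ + X]big1 ?addr0; last first.
    move=> j _; case: eqP => [e|_]; last by rewrite mul0r.
    by case/eqP: i0; apply: val_inj.
  have [i' ei] : exists i', i = lift ord0 i'.
    by case: (unliftP ord0 i) i0 => [i' ->|->]; [exists i' | rewrite eqxx].
  rewrite /rim_sum (bigD1 i') //= [in RHS](bigD1 i') //= ei eqxx mul0r add0r.
  rewrite [in RHS]addrAC addrN add0r.
  apply: eq_bigr => j ji; rewrite (inj_eq (@lift_inj _ ord0)) eq_sym.
  by rewrite ji mul1r.
rewrite /kite_adj /= [X in _ + X + _]big1 ?addr0; last by move=> j _; rewrite mul0r.
have split_sum : \sum_(j < q) ((k.+1 == j)%N || (j.+1 == k)%N)%:R * f (inr j) =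
   \sum_(j < q) (j.+1 == k)%N%:R * f (inr j) + tail_value k.+2.
  rewrite -(pick (fun j : 'I_q => k.+1 == j)%N) => [|j]; last by rewrite eq_sym.
  rewrite -big_split; apply: eq_bigr => j _ /=; rewrite -mulrDl; congr (_ * _).
  have [<-|_] := eqVneq k.+1 (nat_of_ord j); last by rewrite addr0.
  by rewrite gtn_eqF // add0r.
rewrite split_sum addrA; congr (_ + _).
case: (nat_of_ord k) => [|k'] /=.
  by rewrite mul1r big1 ?addr0 // => j _; rewrite mul0r.
by rewrite mul0r add0r; apply: (pick (fun j : 'I_q => j.+1 == k'.+1)%N) => j.
Qed.

End KiteVectors.

(** [cheb a k.+1] is the Chebyshev polynomial of the second kind U_k at a / 2. *)
Fixpoint cheb (a : algC) (k : nat) : algC :=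
  match k with
  | 0%N => 0
  | 1%N => 1
  | (k'.+1 as k1).+1 => a * cheb a k1 - cheb a k'
  end.

Lemma chebSS a k : cheb a k.+2 = a * cheb a k.+1 - cheb a k.
Proof. by []. Qed.

Lemma chebN a k : cheb (- a) k = - ((-1) ^+ k * cheb a k).
Proof.
suff: cheb (- a) k = - ((-1) ^+ k * cheb a k) /\
      cheb (- a) k.+1 = - ((-1) ^+ k.+1 * cheb a k.+1) by case.
elim: k => [|k [IH1 IH2]]; first by split; rewrite /= ?expr1; ring.
by split=> //; rewrite !chebSS IH1 IH2 !exprS; ring.
Qed.

Lemma cheb_consecutive a k : cheb a k = 0 -> cheb a k.+1 != 0.
Proof.
elim: k => [_|k IH k1]; first exact: oner_neq0.
apply/eqP => k2; have /IH : cheb a k = 0; last by rewrite k1 eqxx.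
by move: k2; rewrite chebSS k1 mulr0 sub0r => /eqP; rewrite oppr_eq0 => /eqP.
Qed.

Lemma cheb2 k : cheb 2 k = k%:R.
Proof.
suff: cheb 2 k = k%:R /\ cheb 2 k.+1 = k.+1%:R by case.
by elim: k => [|k [IH1 IH2]]; split=> //; rewrite chebSS IH1 IH2 -!natr1; ring.
Qed.

(** At a = 1 the sequence has period 6: 0, 1, 1, 0, -1, -1. *)
Lemma cheb1 k : exists2 s : algC, s != 0 &
  [\/ (cheb 1 k = 0 /\ cheb 1 k.+1 = s), (cheb 1 k = s /\ cheb 1 k.+1 = s) |
      (cheb 1 k = s /\ cheb 1 k.+1 = 0)].
Proof.
elim: k => [|k [s s0 IH]].
  by exists 1; [exact: oner_neq0 | constructor 1].
case: IH => -[e1 e2].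
- by exists s; [|constructor 2; rewrite chebSS e1 e2; split=> //; ring].
- by exists s; [|constructor 3; rewrite chebSS e1 e2; split=> //; ring].
exists (- s); first by rewrite oppr_eq0.
by constructor 1; rewrite chebSS e1 e2; split=> //; ring.
Qed.

Lemma cheb_gt0 a k : 2 <= a -> (0 < k)%N -> 0 < cheb a k.
Proof.
move=> a2; case: k => // k _.
suff [k0 k1] : 0 <= cheb a k /\ cheb a k + 1 <= cheb a k.+1.
  by apply: lt_le_trans k1; apply: ltr_pwDr.
elim: k => [|k [IH1 IH2]]; first by rewrite /= add0r.
have k1 : 0 <= cheb a k.+1 by apply: le_trans IH2; rewrite addr_ge0.
split=> //; rewrite chebSS -lerBrDl.
have -> : a * cheb a k.+1 - cheb a k - cheb a k.+1 =
   (a - 2) * cheb a k.+1 + (cheb a k.+1 - cheb a k) by ring.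
rewrite -[X in X <= _]add0r lerD //; first by rewrite mulr_ge0 // subr_ge0.
by rewrite lerBrDl.
Qed.

(** Read from the end, the tail values are multiples of the Chebyshev sequence, so
    they determine the value at the junction and, by the equation there, the sum over
    the rest of the clique. Summing the equations over the rest of the clique
    relates the two. If the multiple is zero, the function lives on the rest of
    the clique with sum zero, where the eigenvalue is -1. *)
Lemma kite_secular p q a :
  eigenvalue (adjacency_mx (kite p.+1 q)) a -> a != -1 ->
  (a - p%:R + 1) * cheb a q.+2 = p%:R * cheb a q.+1.
Proof.
move=> /eigenvalueE[f Af [v fv]] a1.
have Av w := esym (etrans (esym (kite_actionE f w)) (Af w)).
set t := tail_value f; set X := rim_sum f; set c := t q.
have At0 : a * t 0%N = X + t 1%N by rewrite (Av (inl ord0)) eqxx.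
have Atk k : (k < q)%N -> a * t k.+1 = t k + t k.+2.
  by move=> lt_k; rewrite /t -[k]/(val (Ordinal lt_k)) tail_valueS (Av (inr _)).
have Ax i : a * f (inl (lift ord0 i)) = t 0%N + X - f (inl (lift ord0 i)).
  by rewrite (Av (inl _)) lift_eqF.
have tE k : (k <= q.+1)%N -> t (q.+1 - k)%N = cheb a k * c.
  suff: ((k <= q.+1)%N -> t (q.+1 - k)%N = cheb a k * c) /\
        ((k.+1 <= q.+1)%N -> t (q.+1 - k.+1)%N = cheb a k.+1 * c) by case.
  elim: k => [|k [IH1 IH2]]; split=> // le_k.
  - by rewrite subn0 mul0r; apply: tail_value_end.
  - by rewrite subSS subn0 mul1r.
  have [i ei] : exists i, (q.+1 - k.+2)%N = i /\ (i < q)%N by exists (q.+1 - k.+2)%N; lia.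
  have [e0 lt_i] := ei; rewrite e0.
  have e1 : (q.+1 - k.+1)%N = i.+1 by lia.
  have e2 : (q.+1 - k)%N = i.+2 by lia.
  have := Atk i lt_i; rewrite -e2 -e1 IH1 ?IH2; try lia.
  by rewrite chebSS => e; rewrite mulrBl -mulrA e addrK.
have t0 : t 0%N = cheb a q.+1 * c by rewrite -tE // subnn.
have eX : X = cheb a q.+2 * c.
  rewrite chebSS mulrBl -mulrA -t0 At0 -(tE q) // subSn // subnn.
  by rewrite addrK.
have eqX : (a - p%:R + 1) * X = p%:R * t 0%N.
  have : \sum_(i < p) a * f (inl (lift ord0 i)) = p%:R * (t 0%N + X) - X.
    under eq_bigr => i _ do rewrite Ax.
    by rewrite sumrB sumr_const card_ord mulr_natl.
  by rewrite -mulr_sumr -/X => e; rewrite mulrDl mulrBl e mul1r; ring.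
have [c0|c0] := eqVneq c 0; last first.
  by apply: (mulIf c0); rewrite -mulrA -eX eqX t0 mulrA.
case/eqP: fv; have X0 : X = 0 by rewrite eX c0 mulr0.
have t00 : t 0%N = 0 by rewrite t0 c0 mulr0.
case: v => [i|k].
  case: (unliftP ord0 i) => [i'|] -> //.
  have := Ax i'; rewrite X0 t00 !add0r => e.
  have : (a + 1) * f (inl (lift ord0 i')) == 0 by rewrite mulrDl e mul1r addNr.
  by rewrite mulf_eq0 addr_eq0 (negPf a1) => /eqP.
rewrite -tail_valueS -/t; have -> : k.+1 = (q.+1 - (q - k))%N.
  by have := ltn_ord k; lia.
by rewrite tE ?c0 ?mulr0 //; lia.
Qed.

(** The relations for a and - a involve the same two Chebyshev values up to sign;
    their difference makes one of them vanish, hence both, which is impossible for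
    consecutive terms. The eigenvalue -1, not governed by the relation, is handled
    by its partner 1. *)
Lemma kite_spectrum_asym p q a : (2 < p)%N ->
  eigenvalue (adjacency_mx (kite p.+1 q)) a ->
  ~~ eigenvalue (adjacency_mx (kite p.+1 q)) (- a).
Proof.
move=> p3; have not1 : ~~ eigenvalue (adjacency_mx (kite p.+1 q)) 1.
  apply/negP => /kite_secular; have /negPf neq : (1 : algC) != -1.
    by rewrite -subr_eq0 opprK (_ : 1 + 1 = 2%:R) // pnatr_eq0.
  rewrite neq => /(_ isT).
  have p0 : (p%:R : algC) != 0 by rewrite pnatr_eq0; lia.
  have [s s0 [][-> ->]] := cheb1 q.+1.
  - move/eqP; rewrite mulr0 mulf_eq0 (negPf s0) orbF.
    rewrite -addrA addrC -addrA addrC subr_eq0 (_ : 1 + 1 = 2%:R) // eqr_nat.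
    by lia.
  - move/(mulIf s0)/eqP; rewrite -addrA addrC -addrA addrC subr_eq.
    by rewrite -natrD (_ : 1 + 1 = 2%:R) // eqr_nat; lia.
  by move/eqP; rewrite mulr0 eq_sym mulf_eq0 (negPf s0) (negPf p0).
move=> ea; apply/negP => eNa.
have aN1 : a != -1 by apply: contraNneq not1 => e; rewrite e opprK in eNa.
have a1 : - a != -1 by rewrite eqr_opp; apply: contraNneq not1 => <-.
have := kite_secular eNa a1; have := kite_secular ea aN1.
rewrite !chebN !exprS; set s := (-1) ^+ q; set U := cheb a q.+1; set V := cheb a q.+2.
move=> e1 e2.
have s2 : s * s = 1 by rewrite -expr2 sqrr_sign.
have e2' : (a + p%:R - 1) * V = p%:R * U.
  have : s * ((- a - p%:R + 1) * - (-1 * (-1 * s) * V)) = s * (p%:R * - (-1 * s * U)).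
    by rewrite e2.
  rewrite (_ : s * _ = (s * s) * ((a + p%:R - 1) * V)); last by ring.
  by rewrite (_ : s * (p%:R * _) = (s * s) * (p%:R * U)); [rewrite s2 !mul1r | ring].
have p0 : (p%:R : algC) != 0 by rewrite pnatr_eq0; lia.
have p1 : (p%:R - 1 : algC) != 0 by rewrite subr_eq0 (eqr_nat _ p 1); lia.
have V0 : V = 0.
  have : 2 * (p%:R - 1) * V = 0.
    rewrite (_ : _ * V = (a + p%:R - 1) * V - (a - p%:R + 1) * V); last by ring.
    by rewrite e1 e2' subrr.
  by move/eqP; rewrite !mulf_eq0 (negPf p1) pnatr_eq0 => /eqP.
have U0 : U = 0.
  by move/eqP: e1; rewrite V0 mulr0 eq_sym mulf_eq0 (negPf p0) => /eqP.
by have := cheb_consecutive U0; rewrite -/V V0 eqxx.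
Qed.

Lemma kite_not_eigenvalue2 p q : (0 < q)%N ->
  ~~ eigenvalue (adjacency_mx (kite p.+1 q)) 2.
Proof.
move=> q0; apply/negP => /kite_secular; rewrite !cheb2.
have -> : (2 : algC) != -1 by rewrite -subr_eq0 opprK -(natrD _ 2 1) pnatr_eq0.
move=> /(_ isT)/eqP; rewrite -subr_eq0.
have -> : (2 - p%:R + 1) * q.+2%:R - p%:R * q.+1%:R =
   (3 * q.+2)%:R - (p * (2 * q + 3))%:R :> algC.
  by rewrite -[q.+2]addn2 -[q.+1]addn1 !(natrM, natrD); ring.
rewrite subr_eq0 eqr_nat; case: p => [|[|[|p]]]; nia.
Qed.

(** At a = p the relation reduces to the vanishing of [cheb p q], which is
    positive. *)
Lemma kite_not_eigenvalue_clique p q : (1 < p)%N -> (0 < q)%N ->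
  ~~ eigenvalue (adjacency_mx (kite p.+1 q)) p%:R.
Proof.
move=> p1 q0; apply/negP => /kite_secular.
have -> : (p%:R : algC) != -1.
  by rewrite -subr_eq0 opprK natr1 pnatr_eq0.
move=> /(_ isT); rewrite subrr add0r mul1r chebSS => /eqP.
rewrite -subr_eq0 addrAC subrr add0r oppr_eq0 gt_eqF // cheb_gt0 //.
by rewrite (ler_nat _ 2).
Qed.

(** Summation by parts on the path: the form of 2 - A is a sum of squares of
    differences and boundary terms. *)
Lemma path_telescope (t : nat -> algC) m :
  (2 * t 0%N - t 1%N) * (t 0%N)^* +
  \sum_(k < m) (2 * t k.+1 - (t k + t k.+2)) * (t k.+1)^* =
  `|t 0%N| ^+ 2 + \sum_(k < m) `|t k - t k.+1| ^+ 2 + (t m - t m.+1) * (t m)^*.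
Proof.
elim: m => [|m IH]; first by rewrite !big_ord0 !addr0 normCK; ring.
rewrite !big_ord_recr /= addrA IH (normCK (t m - t m.+1)) rmorphB /=; set S := \sum_(i < m) _.
by ring.
Qed.

(** On functions with zero sum over the clique without its junction, the clique
    contributes -1 and decouples from the tail. *)
Lemma kite_form_gap p q (f : kite p.+1 q -> algC) : rim_sum f = 0 ->
  2 * (\sum_v `|f v| ^+ 2) - adj_form f =
  3 * (\sum_(i < p) `|f (inl (lift ord0 i))| ^+ 2) +
  (`|tail_value f 0| ^+ 2
   + \sum_(k < q) `|tail_value f k - tail_value f k.+1| ^+ 2
   + `|tail_value f q| ^+ 2).
Proof.
move=> X0; have := path_telescope (tail_value f) q.
rewrite tail_value_end subr0 -normCK => <-.
rewrite /adj_form mulr_sumr -sumrB.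
rewrite (eq_bigr (fun v => (2 * f v - \sum_w (adj v w)%:R * f w) * (f v)^*)); last first.
  by move=> v _; rewrite normCK mulrBl mulrA.
rewrite big_sumType /= big_ord_recl [RHS]addrCA -addrA; congr (_ + _).
  by rewrite (kite_actionE f (inl ord0)) eqxx X0 add0r.
congr (_ + _).
  rewrite (eq_bigr (fun i => 3 * `|f (inl (lift ord0 i))| ^+ 2
     - tail_value f 0 * (f (inl (lift ord0 i)))^*)) => [|i _].
    by rewrite sumrB -!mulr_sumr -rmorph_sum -/(rim_sum f) X0 rmorph0 mulr0 subr0.
  by rewrite (kite_actionE f (inl _)) lift_eqF X0 addr0 normCK; ring.
by apply: eq_bigr => k _; rewrite (kite_actionE f (inr _)) -tail_valueS.
Qed.

Lemma kite_form_definite p q (f : kite p.+1 q -> algC) : rim_sum f = 0 ->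
  2 * (\sum_v `|f v| ^+ 2) - adj_form f <= 0 -> forall v, f v = 0.
Proof.
move=> X0; rewrite kite_form_gap //.
set SX := \sum_(i < p) _; set SD := \sum_(k < q) _ => le0.
have sqr_eq0 (z : algC) : `|z| ^+ 2 == 0 -> z = 0.
  by rewrite expf_eq0 /= normr_eq0 => /eqP.
have n0 (z : algC) : 0 <= `|z| ^+ 2 by rewrite exprn_ge0.
have SX0 : 0 <= SX by rewrite sumr_ge0.
have SD0 : 0 <= SD by rewrite sumr_ge0.
have: 3 * SX + (`|tail_value f 0| ^+ 2 + SD + `|tail_value f q| ^+ 2) == 0.
  by rewrite eq_le le0 !addr_ge0 // mulr_ge0.
rewrite !paddr_eq0 ?addr_ge0 ?mulr_ge0 //.
rewrite mulf_eq0 pnatr_eq0 /= => /and3P[/eqP eX /andP[et0 /eqP eD] _].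
have t0 := sqr_eq0 _ et0.
have sqr0 n (F : 'I_n -> algC) : \sum_i `|F i| ^+ 2 = 0 -> forall i, F i = 0.
  move/eqP; rewrite psumr_eq0 // => /allP F0 i.
  by apply: sqr_eq0; apply: F0; apply: mem_index_enum.
have tk k : (k <= q)%N -> tail_value f k = 0.
  elim: k => // k IH lt_k; have /eqP := sqr0 _ _ eD (Ordinal lt_k).
  by rewrite subr_eq0 IH ?(ltnW lt_k) // => /eqP.
case=> [i|k]; last by rewrite -tail_valueS tk.
by case: (unliftP ord0 i) => [i'|] -> //; exact: (sqr0 _ _ eX i').
Qed.

(** Two eigenvalues at least 2 would give a plane on which 2 - A is nonpositive; it
    meets the hyperplane of [kite_form_definite] in a nonzero function. *)
Lemma kite_large_eigenvalues p q : (large_eigenvalues (kite p.+1 q) <= 1)%N.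
Proof.
rewrite large_eigenvaluesE; apply/card_le1_eqP => i j; rewrite !inE => ei ej.
apply/eqP/negPn/negP => neq_ij.
set b := @basis_fun (kite p.+1 q).
(* A combination of the two eigenfunctions that lies in the hyperplane. *)
have [a [c [ac cab]]] : exists a c : algC, ((a != 0) || (c != 0)) /\
    a * rim_sum (b i) + c * rim_sum (b j) = 0.
  have [c0|c0] := eqVneq (rim_sum (b i)) 0.
    by exists 1, 0; rewrite oner_neq0 c0; split=> //; ring.
  exists (- rim_sum (b j)), (rim_sum (b i)); rewrite c0 orbT; split=> //; ring.
pose f x := a * b i x + c * b j x.
have X0 : rim_sum f = 0.
  by rewrite -cab /rim_sum !mulr_sumr -big_split.
have cf k : eig_coord f k = a * (i == k)%:R + c * (j == k)%:R.
  rewrite -!basis_ortho !mulr_sumr -big_split; apply: eq_bigr => x _ /=.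
  by rewrite /f /b; ring.
have f0 : forall v, f v = 0.
  apply: kite_form_definite X0 _; rewrite gap_formE -oppr_ge0 -sumrN.
  apply: sumr_ge0 => k _; rewrite -mulNr opprB cf.
  have [<-|ik] := eqVneq i k; first by rewrite mulr_ge0 ?exprn_ge0 // subr_ge0.
  have [<-|jk] := eqVneq j k; first by rewrite mulr_ge0 ?exprn_ge0 // subr_ge0.
  by rewrite !mulr0 addr0 normr0 expr0n mulr0.
have eig0 k : eig_coord f k = 0.
  by rewrite /eig_coord big1 // => x _; rewrite f0 mul0r.
move: (cf i) (cf j); rewrite !eig0 !eqxx (negPf neq_ij) eq_sym (negPf neq_ij).
by rewrite !mulr1 !mulr0 addr0 add0r => a0 c0; rewrite -a0 -c0 eqxx in ac.
Qed.

Local Close Scope sesquilinear_scope.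
Local Close Scope ring_scope.

(** * Graphs cospectral with a kite *)

(** The indicator of a k-regular union of components is an eigenfunction. *)
Lemma closed_regular_eigenvalue (G : sgraph) (W : {set G}) (x : G) k :
  adj_closed W -> x \in W -> {in W, forall y, deg y = k} ->
  eigenvalue (adjacency_mx G) (k%:R)%R.
Proof.
move=> cW xW degW; apply/eigenvalueE.
exists (fun y => ((y \in W)%:R)%R); last by exists x; rewrite xW oner_neq0.
move=> y; have [yW|yW] := boolP (y \in W); last first.
  rewrite mulr0 big1 // => z _; case yz: (adj y z); last by rewrite mul0r.
  have := adj_closedC cW; move=> /(_ y z); rewrite !inE yW yz => /(_ isT isT).
  by move=> /negPf->; rewrite mulr0.
rewrite mulr1 -(degW y yW) degE natr_sum; apply: eq_bigr => z _.
by case yz: (adj y z); rewrite ?mul0r // (cW y z yW yz) mulr1.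
Qed.

(** Comparison of closed 4-walks: [kite_walks4] for the kite, [walks4_clique] for
    G. When the kite has a clique of at most three vertices, the clique term is
    zero and Q may be empty. *)
Lemma excess_le (G : sgraph) (Q : {set G}) p q : 0 < q ->
  same_spectrum G (kite p.+1 q) -> clique Q ->
  p.+1 * (p * (p.-1 * p.-1.-1)) <= #|Q| * (#|Q|.-1 * (#|Q|.-2 * #|Q|.-2.-1)) ->
  \sum_(x : G) excess (deg x) <= excess p.+1 + p * excess p.
Proof.
move=> q0 /same_spectrum_moments[eqn eqm _ eqw] cQ le_Q.
have sumE (H : sgraph) : \sum_(x : H) excess (deg x) + 3 * \sum_(x : H) deg x =
    \sum_(x : H) deg x ^ 2 + 2 * #|H|.
  rewrite [2 * _]mulnC -sum_nat_const big_distrr -!big_split /=.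
  by apply: eq_bigr => x _; rewrite excessE.
rewrite -(kite_excess p q0); have := sumE G; have := sumE (kite p.+1 q).
have := walks4_clique cQ; have := kite_walks4 p q0.
move: eqm; rewrite !arcsT eqn eqw => ->; lia.
Qed.

(** For p <= 1 the kite is a path, which is also the kite on a single clique
    vertex: a leaf of G serves as the junction. *)
Lemma path_recognition (G : sgraph) p q : 0 < q -> p <= 1 ->
  same_spectrum G (kite p.+1 q) -> isomorphic G (kite 1 (p + q)).
Proof.
move=> q0 p1 GK; have [eqn eqm _ _] := same_spectrum_moments GK.
rewrite card_sum !card_ord in eqn; rewrite kite_arcs // arcsT in eqm.
have no2 (W : {set G}) : adj_closed W -> {in W, forall x, deg x = 2} -> W = set0.
  move=> cW dW; have [->//|[x xW]] := set_0Vmem W.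
  have := closed_regular_eigenvalue cW xW dW.
  by rewrite (same_spectrum_eigenvalue _ GK) (negPf (kite_not_eigenvalue2 p q0)).
have deg12 (x : G) : 0 < deg x <= 2.
  apply: excess0; apply/eqP.
  have c0 : clique (set0 : {set G}) by move=> u v; rewrite inE.
  have := @excess_le G set0 p q q0 GK c0; case: p p1 {GK eqn eqm} => [|[|]] //= _ /(_ isT);
    rewrite leqn0 sum_nat_eq0 => /forallP/(_ x) //.
have [v0 leaf] : exists v0 : G, deg v0 = 1.
  suff /existsP[v0 /eqP leaf] : [exists v0 : G, deg v0 == 1] by exists v0.
  apply: contraT; rewrite negb_exists => /forallP no1.
  have d2 : {in [set: G], forall x, deg x = 2}.
    by move=> x _; have := no1 x; have := deg12 x; lia.
  have /setP allG0 := no2 _ (fun _ v _ _ => in_setT v) d2.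
  have /card_gt0P[x _] : 0 < #|G| by rewrite eqn.
  by have := allG0 x; rewrite !inE.
rewrite -(cards1 v0); apply: kite_recognition => //.
- split=> //; first by move=> x y /set1P-> /set1P->; rewrite eqxx.
  + by rewrite inE.
  + by rewrite cards1.
  by move=> x /set1P->; rewrite eqxx.
- by rewrite cards1 eqn; lia.
by rewrite cards1 eqm; case: p p1 {GK eqn eqm} => [|[|]] //; lia.
Qed.

(** Three clique vertices need only one triangle; otherwise G is connected and
    attains the extremal number of triangles. *)
Lemma clique_in_cospectral (G : sgraph) p q : 0 < q -> 1 < p ->
  same_spectrum G (kite p.+1 q) -> exists2 Q : {set G}, clique Q & #|Q| = p.+1.
Proof.
move=> q0 p1 GK; have [eqn eqm eqt _] := same_spectrum_moments GK.
have := kite_clique p q => -[QK cQK cardQK]; have := triads_clique cQK.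
rewrite cardQK -eqt /= => le_t; rewrite card_sum !card_ord in eqn.
have [p2|p2] := leqP p 2.
  have -> : p = 2 by lia.
  apply: triads_triangle; apply: leq_trans le_t.
  by rewrite !muln_gt0; lia.
apply: (@triads_extremal G [set: G]) => //.
- apply: spectrum_connected; first by rewrite eqn.
    move=> a; rewrite !(same_spectrum_eigenvalue _ GK).
    exact: kite_spectrum_asym.
  rewrite /large_eigenvalues (permP GK); exact: kite_large_eigenvalues.
- rewrite eqm kite_arcs // cardsT eqn.
  by case: p {GK eqn eqm eqt cardQK QK cQK le_t p1 p2} => [|p] /=; lia.
by rewrite -mulnA.
Qed.

Theorem theorem3p7 (p q : nat) (hp : 1 <= p) : determined_by_spectrum (kite p q).
Proof.
case: p hp => // p _ G GK.
have [eqn eqm _ _] := same_spectrum_moments GK.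
have [q0|q0] := posnP q.
  subst q; have cK : clique [set: kite p.+1 0].
    by move=> [i|[]//] [j|[]//] _ _.
  apply: isomorphic_complete => //; apply: arcs_clique.
  rewrite eqm cardsT eqn arcsT -sum_nat_const; apply: leq_sum => x _.
  by have := clique_deg cK (in_setT x); rewrite cardsT.
have [p1|p1] := leqP p 1.
  apply: isomorphic_trans (path_recognition q0 p1 GK) _.
  by apply/isomorphic_sym/path_recognition => //; rewrite /same_spectrum perm_refl.
have [Q cQ cardQ] := clique_in_cospectral q0 p1 GK.
rewrite kite_arcs // arcsT in eqm; rewrite card_sum !card_ord in eqn.
(* Otherwise Q is a p-regular component, and p is not an eigenvalue of the kite. *)
have [v0 v0Q degv0] : exists2 v0, v0 \in Q & #|Q| <= deg v0.
  apply/exists_inP; apply: contraT; rewrite negb_exists_in => /forall_inP small.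
  have degQ : {in Q, forall x, deg x = p}.
    by move=> x xQ; have := small x xQ; have := clique_deg cQ xQ; rewrite cardQ; lia.
  have cloQ : adj_closed Q.
    move=> x y xQ xy; have : nbhd [set: G] x == Q :\ x.
      rewrite eq_sym eqEcard -[X in X <= _]/(deg x) degQ //.
      have := cardsD1 x Q; rewrite xQ cardQ => -[->]; rewrite leqnn andbT.
      apply/subsetP => z; rewrite in_nbhdT !inE => /andP[zx zQ].
      by apply: cQ; rewrite // eq_sym.
    by move=> /eqP/setP/(_ y); rewrite in_nbhdT xy !inE => /esym/andP[].
  have /card_gt0P[x xQ] : 0 < #|Q| by rewrite cardQ.
  have := closed_regular_eigenvalue cloQ xQ degQ.
  by rewrite (same_spectrum_eigenvalue _ GK) (negPf (kite_not_eigenvalue_clique p1 q0)).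
have kQ : kite_degrees Q v0.
  apply: excess_rigid => //; rewrite cardQ //.
  by apply: excess_le q0 GK cQ _; rewrite cardQ.
rewrite -cardQ; apply: (kite_recognition kQ); rewrite ?cardQ //.
move=> W cW dW; have [->//|[x xW]] := set_0Vmem W.
have := closed_regular_eigenvalue cW xW dW.
by rewrite (same_spectrum_eigenvalue _ GK) (negPf (kite_not_eigenvalue2 p q0)).
Qed.
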